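(* Let $x,y,z$ be nonnegative integers with $x\not\equiv z\pmod 2$, and let $\mathbf a=(a_1,\dots,a_m)$, $\mathbf b=(b_1,\dots,b_n)$, $\mathbf c=(c_1,\dots,c_k)$ be sequences of nonnegative integers with $m,n,k$ positive even integers. Put $g=\lfloor\frac{x+z}{2}\rfloor$, $g'=\lceil\frac{x+z}{2}\rceil$, $\mu=\max(a,b)$, $\nu=\min(a,b)$. Then \begin{align*} \operatorname{M}(R^{\leftarrow}_{x,y,z}(\mathbf a;\mathbf c;\mathbf b))=&\operatorname{M}(C_{x,2y+z+2\mu,z}(c))\\ &\times s\left(y+b-\nu,a_1,\dots,a_m,g,c_1,\dots,c_{k-1},c_k+g'+b_n,b_{n-1},\dots,b_1\right)\\ &\times s\left(a_1,\dots,a_{m-1},a_m+g+c_1,c_2,\dots,c_k,g',b_n,\dots,b_1,y+a-\nu\right)\\ &\times\frac{\operatorname{H}(c+g)}{\operatorname{H}(c)\operatorname{H}(g)}\frac{\operatorname{H}(\mu+y+g)}{\operatorname{H}(\mu+c+y+g)}\\ &\times \frac{\operatorname{H}(\mu+y+z)\operatorname{H}(\mu+c+y+z)}{\operatorname{H}(\mu-o_a+o_b+o_c+y+z)\operatorname{H}(\mu+o_a-o_b+e_c+y+z)}\\ &\times \frac{\operatorname{H}(\mu-o_a+o_b+o_c+y)\operatorname{H}(\mu+o_a-o_b+e_c+y)}{\operatorname{H}(\mu+y)^2}. \end{align*}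
   Context: Work on the triangular lattice drawn with horizontal lattice lines. A lozenge is the union of two unit triangles sharing an edge; a (lozenge) tiling of a region is a covering by lozenges without gaps or overlaps; $\operatorname{M}(R)$ denotes the number of tilings of $R$. Vertical distances are measured in rows (the height of a unit triangle); ''the horizontal lattice line at level $t$ above a point $P$'' is the horizontal lattice line $t$ rows above $P$. Lattice hexagons have all angles $120^\circ$ and their side-lengths are listed clockwise starting from the horizontal top side: north, northeast, southeast, south, southwest, northwest. The east vertex is the common vertex of the northeast and southeast sides; the west vertex is the common vertex of the southwest and northwest sides. Hyperfactorial: $\operatorname{H}(n)=0!\,1!\cdots(n-1)!$ for nonnegative integers $n$ ($\operatorname{H}(0)=1$). For a sequence $\mathbf t=(t_1,\dots,t_r)$ of nonnegative integers, $o_t=\sum_{i\text{ odd}}t_i$, $e_t=\sum_{i \text{ even}}t_i$, and $t=t_1+\dots+t_r$; so $a,b,c,o_a,e_a,o_b,\dots$ refer to $\mathbf a,\mathbf b,\mathbf c$. Dented semihexagon: $s(t_1,\dots,t_r)$ is the number of tilings of the region obtained from the trapezoid with horizontal top side of length $e_t$, horizontal bottom side of length $o_t+e_t$, and two slanted sides of length $o_t$, by removing from its bottom side up-pointing triangles of side-lengths $t_1,t_3,t_5,\dots$ from left to right, the first starting at the left end of the bottom side and consecutive removed triangles separated along the bottom side by distances $t_2,t_4,\dots$. (Equivalently, $s(t_1,\dots,t_{2l-1})=s(t_1,\dots,t_{2l})=\frac{1}{\operatorname{H}(t_1+t_3+\dots+t_{2l-1})}\frac{\prod_{1\le i<j\le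 2l-1,\ j-i\text{ odd}}\operatorname{H}(t_i+\dots+t_j)}{\prod_{1\le i<j\le 2l-1,\ j-i\text{ even}}\operatorname{H}(t_i+\dots+t_j)}$.) Cored hexagon: for nonnegative integers $X,Y,Z,p$, $C_{X,Y,Z}(p)$ is obtained from the hexagon $H$ with side-lengths $X,Y+p,Z,X+p,Y,Z+p$ as follows. Let $H_0$ be the hexagon with side-lengths $X,Y,Z,X,Y,Z$ whose south, southwest and northwest sides lie on the lines of the south, southwest and northwest sides of $H$; let $O$ be the center of symmetry of $H_0$. Remove the up-pointing triangle of side $p$ whose left vertex is: $O$ if $X,Y,Z$ all have the same parity; the point $1/2$ unit west of $O$ if $X$ has parity different from $Y$ and $Z$; the point $1/2$ unit from $O$ in the northwest lattice direction if $Y$ has parity different from $X$ and $Z$; the point $1/2$ unit from $O$ in the southwest lattice direction if $Z$ has parity different from $X$ and $Y$. Fern: a string of lattice triangles of side-lengths $t_1,\dots,t_r$ (side $0$ allowed) with alternating orientations, all having a horizontal side on a common horizontal lattice line $\ell$ (up-pointing ones above $\ell$, down-pointing ones below), consecutive triangles meeting at a vertex on $\ell$; it occupies a segment of $\ell$ of length $t_1+\dots+t_r$. Removing a fern means removing the union of its triangles. The region $R^{\leftarrow}_{x,y,z}(\mathbf a;\mathbf c;\mathbf b)$ (for $x\not\equiv z \pmod 2$): let $H$ be the hexagon with side-lengths $x+o_a+e_b+e_c$, $2y+z+e_a+o_b+o_c+|a-b|$, $z+o_a+e_b+e_c$, $x+e_a+o_b+o_c$, $2y+z+o_a+e_b+e_c+|a-b|$,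 $z+e_a+o_b+o_c$. Let $\ell$ be the horizontal lattice line at level $y$ above the east vertex of $H$ if $a\le b$, and at level $y+a-b$ if $a>b$; $\ell\cap H$ is a segment of length $x+z+a+b+c$. Remove from $H$ three ferns along $\ell$: the left fern with side-lengths $a_1,\dots,a_m$ from left to right, $a_1$ down-pointing, starting at the left endpoint of $\ell\cap H$; the right fern with side-lengths $b_1,\dots,b_n$ read from right to left, $b_1$ up-pointing, ending at the right endpoint of $\ell\cap H$; and the middle fern with side-lengths $c_1,\dots,c_k$ from left to right, $c_1$ up-pointing, placed so that the distance along $\ell$ from the right end of the left fern to the left end of the middle fern is $\lfloor\frac{x+z}{2}\rfloor$ and the distance from the right end of the middle fern to the left end of the right fern is $\lceil\frac{x+z}{2}\rceil$. *)

(* Defs.v *)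
From mathcomp Require Import all_boot.
From mathcomp Require Import finmap.

Set Implicit Arguments.
Unset Strict Implicit.
Unset Printing Implicit Defensive.

Local Open Scope fset_scope.
Local Open Scope nat_scope.

(* The lattice point (i, j) stands for i * e1 + j * e2, where e1 is the unit
   vector pointing east and e2 the unit vector at 60 degrees; j is thus the
   index of a horizontal lattice line, and the northwest lattice direction is
   e2 - e1.  All the regions below lie in the quadrant i, j >= 0. *)
Definition point : Type := (nat * nat)%type.

(* The cell (true, (i, j)) is the up-pointing unit triangle with left vertex
   (i, j); the cell (false, (i, j)) is the down-pointing unit triangle sharing
   the northeast edge of the former. *)
Definition cell : Type := (bool * (nat * nat))%type.

Definition vertices (u : cell) : seq point :=
  let: (up, (i, j)) := u in
  if up then [:: (i, j); (i.+1, j); (i, j.+1)]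
  else [:: (i.+1, j); (i.+1, j.+1); (i, j.+1)].

Definition share_edge (u v : cell) : bool :=
  count [in vertices v] (vertices u) == 2.

Definition lozenges (R : {fset cell}) : {fset {fset cell}} :=
  [fset L in fpowerset R |
    [exists u : R, exists v : R,
      share_edge (val u) (val v) && (L == [fset val u; val v])]].

Definition tilings (R : {fset cell}) : {fset {fset {fset cell}}} :=
  [fset T in fpowerset (lozenges R) |
    [forall u : R, #|` [fset L in T | val u \in L] | == 1]].

Definition M (R : {fset cell}) : nat := #|` tilings R|.

(* Hexagon with the given sides, placed with its west vertex at (0, sw).  Going
   around from there, its vertices are (0, sw), (0, sw + nw), (n, sw + nw),
   (sw + s, se), (sw + s, 0) and (sw, 0).  The polygon closes up if and only if
   n + nw = s + se and ne + se = nw + sw, so that n and ne are determined by the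
   other four sides.  Some sides may be 0. *)
Definition hexagon (n ne se s sw nw : nat) : {fset cell} :=
  [fset u in [seq (up, ij) | up <- [:: true; false],
                             ij <- [seq (i, j) | i <- iota 0 (sw + s),
                                                 j <- iota 0 (sw + nw)]] |
    all (fun P : point =>
           [&& sw <= P.1 + P.2 <= sw + s + se, P.1 <= sw + s
             & P.2 <= sw + nw])
        (vertices u)].

(* Lattice triangle of side t whose horizontal side has left end P; it lies above
   that side if up, and below it otherwise. *)
Definition in_triangle (up : bool) (P : point) (t : nat) (u : cell) : bool :=
  all (fun Q : point =>
         if up then [&& P.1 <= Q.1, P.2 <= Q.2 & Q.1 + Q.2 <= P.1 + P.2 + t]
         else [&& P.1 + P.2 <= Q.1 + Q.2, Q.1 <= P.1 + t & Q.2 <= P.2])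
      (vertices u).

(* Fern with left end P, its sides t being listed from left to right; up is the
   orientation of the leftmost triangle. *)
Fixpoint in_fern (up : bool) (P : point) (t : seq nat) (u : cell) : bool :=
  if t is t1 :: t' then
    in_triangle up P t1 u || in_fern (~~ up) (P.1 + t1, P.2) t' u
  else false.

(* Fern with right end P, its sides t being listed from right to left; up is the
   orientation of the rightmost triangle. *)
Fixpoint in_rfern (up : bool) (P : point) (t : seq nat) (u : cell) : bool :=
  if t is t1 :: t' then
    in_triangle up (P.1 - t1, P.2) t1 u
      || in_rfern (~~ up) (P.1 - t1, P.2) t' u
  else false.

Definition hyperfact (n : nat) : nat := \prod_(i < n) i`!.

(* The terms of a sequence are numbered from 1, those of a seq from 0. *)
Definition osum (t : seq nat) : nat :=
  \sum_(i < size t | ~~ odd i) nth 0 t i.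
Definition esum (t : seq nat) : nat :=
  \sum_(i < size t | odd i) nth 0 t i.

Fixpoint in_dents (P : point) (t : seq nat) (u : cell) : bool :=
  match t with
  | [::] => false
  | [:: t1] => in_triangle true P t1 u
  | [:: t1, t2 & t'] =>
      in_triangle true P t1 u || in_dents (P.1 + t1 + t2, P.2) t' u
  end.

(* A trapezoid is a hexagon whose southeast and southwest sides are 0. *)
Definition dented_semihexagon (t : seq nat) : {fset cell} :=
  let o := osum t in let e := esum t in
  [fset u in hexagon e o 0 (o + e) 0 o | ~~ in_dents (0, 0) t u].

Definition semihex (t : seq nat) : nat := M (dented_semihexagon t).

(* The hexagon H_0 with sides X, Y, Z, X, Y, Z shares the west vertex (0, Y) of
   H, and its east vertex is (X + Y, Z); its center is thus
   ((X + Y) / 2, (Y + Z) / 2).  All the halves below are exact. *)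
Definition core_vertex (X Y Z : nat) : point :=
  if (odd X == odd Y) && (odd Y == odd Z) then ((X + Y)./2, (Y + Z)./2)
  else if odd Y == odd Z then ((X + Y - 1)./2, (Y + Z)./2)
  else if odd X == odd Z then ((X + Y - 1)./2, (Y + Z + 1)./2)
  else ((X + Y)./2, (Y + Z - 1)./2).

Definition cored_hexagon (X Y Z p : nat) : {fset cell} :=
  [fset u in hexagon X (Y + p) Z (X + p) Y (Z + p) |
    ~~ in_triangle true (core_vertex X Y Z) p u].

(* In row q, the hexagon extends from the horizontal coordinate sw - q (0 if
   q >= sw) to the smaller of sw + s and sw + s + se - q. *)
Definition Rleft (x y z : nat) (a c b : seq nat) : {fset cell} :=
  let sa := sumn a in let sb := sumn b in
  let d := maxn sa sb - minn sa sb in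
  let n := x + osum a + esum b + esum c in
  let ne := 2 * y + z + esum a + osum b + osum c + d in
  let se := z + osum a + esum b + esum c in
  let s := x + esum a + osum b + osum c in
  let sw := 2 * y + z + osum a + esum b + esum c + d in
  let nw := z + esum a + osum b + osum c in
  let q := se + (if sa <= sb then y else y + sa - sb) in
  let l := sw - q in
  let r := minn (sw + s) (sw + s + se - q) in
  [fset u in hexagon n ne se s sw nw |
    ~~ [|| in_fern false (l, q) a u,
           in_fern true (l + sa + (x + z)./2, q) c u
         | in_rfern true (r, q) b u]].

(* Main.v *)
(* A tiling of R is cut along the line of the ferns into a tiling of an upper and
   of a lower dented trapezoid, where the lozenges crossing the line sit at a set
   S of z positions inside the two gaps.  A trapezoid with dents at the positions
   P has Vandermonde(P) / H(|P|) tilings, and in the product of the two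
   Vandermonde products the factors involving S only see the union of the dents
   of both halves.  This union consists of three full intervals, whose position
   relative to the gaps depends on y + mu, g, g' and c only; hence the sum over S
   is the same for R and for the cored hexagon, and it cancels in their ratio. *)
From mathcomp Require Import all_boot all_order all_algebra.
From mathcomp Require Import perm finmap zify ring.
Require Import Defs.
Set Implicit Arguments.
Unset Strict Implicit.
Unset Printing Implicit Defensive.
Import GRing.Theory Num.Theory.
Local Open Scope fset_scope.
Local Open Scope nat_scope.

(** * Perfect matching expansion *)

(** The halves of the hexagon are not trapezoids: the upper one becomes one by adding a corner
    triangle of side [y + b - nu] on the left, the lower one by adding a corner triangle of side
    [y + a - nu] on the right. Treated as further dents, these triangles are the first entry of one
    dent sequence and the last entry of the other. Since [(y + b - nu) + a = (y + a - nu) + b = mu +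
    y], the two outer intervals of dents have the same length [mu + y], whatever the shape of the
    ferns. The cored hexagon is itself a region of this family with empty outer ferns, so one count,
    [M_Rleft], serves for both regions. The trapezoid formula comes from peeling off the bottom row:
    the dents of the next row interlace the present ones, and summing a Vandermonde product over
    interlacing lists divides by a factorial. Over all rows these factorials accumulate to the
    hyperfactorial. Counting identities are kept in [nat] with denominators multiplied out; division
    appears only in the final computation. *)

Definition adjacent_up_down (i j i' j' : nat) : bool :=
  [|| (i' == i) && (j' == j), (i'.+1 == i) && (j' == j)
    | (i' == i) && (j'.+1 == j)].

Lemma share_edgeE b i j b' i' j' :
  share_edge (b, (i, j)) (b', (i', j')) =
  if b then ~~ b' && adjacent_up_down i j i' j'
  else b' && adjacent_up_down i' j' i j.
Proof.
(* A vertex coordinate is that of the cell or its successor, so coincidences of vertices depend only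
   on these three comparisons; the last constructor collects all distant cells. *)
have close m n : [\/ m = n, m = n.+1, n = m.+1
    | [/\ (m == n) = false, (m.+1 == n) = false & (m == n.+1) = false]].
  case: (ltngtP m n) => [lt|lt|]; last by constructor 1.
    have [->|] := eqVneq n m.+1; first by constructor 3.
    by move=> ne; constructor 4; split; lia.
  have [->|] := eqVneq m n.+1; first by constructor 2.
  by move=> ne; constructor 4; split; lia.
have S1 n : (n == n.+1) = false by lia.
have S2 n : (n.+1 == n) = false by lia.
have S3 n : (n == n.+2) = false by lia.
have S4 n : (n.+2 == n) = false by lia.
have E := (S1, S2, S3, S4, eqxx, eqSS).
rewrite /share_edge /adjacent_up_down.
case: (close i i') => [->|->|->|[i0 i1 i2]];
  case: (close j j') => [->|->|->|[j0 j1 j2]];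
  case: b; case: b'; rewrite /= !inE !xpair_eqE !E /=;
  rewrite ?i0 ?i1 ?i2 ?j0 ?j1 ?j2 // ?[i' == i]eq_sym ?[j' == j]eq_sym
    ?[i'.+1 == i]eq_sym ?[j'.+1 == j]eq_sym ?[i' == i.+1]eq_sym
    ?[j' == j.+1]eq_sym ?i0 ?i1 ?i2 ?j0 ?j1 ?j2 ?andbF //.
Qed.

Lemma share_edgeC : symmetric share_edge.
Proof.
by move=> [b [i j]] [b' [i' j']]; rewrite !share_edgeE; case: b; case: b'.
Qed.

Lemma share_edgexx u : share_edge u u = false.
Proof. by case: u => [b [i j]]; rewrite share_edgeE; case: b. Qed.

Lemma lozengesP (R : {fset cell}) (L : {fset cell}) :
  reflect (exists u v, [/\ u \in R, v \in R, share_edge u v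
                         & L = [fset u; v]])
          (L \in lozenges R).
Proof.
rewrite !inE /=; apply: (iffP andP) => [[_]|[u [v [uR vR uv ->]]]].
  case/existsP=> u /existsP[v /andP[uv /eqP->]].
  by exists (val u), (val v); split=> //; apply: valP.
split; first by rewrite fpowersetE fsubUset !fsub1set uR vR.
apply/existsP; exists [` uR]; apply/existsP; exists [` vR].
by rewrite /= uv eqxx.
Qed.

Lemma tilingsP (R : {fset cell}) (T : {fset {fset cell}}) :
  reflect ({subset T <= lozenges R} /\
           forall u, u \in R -> exists L, [/\ L \in T, u \in L
             & forall L', L' \in T -> u \in L' -> L' = L])
          (T \in tilings R).
Proof.
rewrite !inE /=; apply: (iffP andP) => [[TR /forallP H]|[TR H]]; split.
- by move: TR; rewrite fpowersetE => /fsubsetP.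
- move=> u uR; have /cardfs1P[L LE] := H [` uR]; exists L.
  have: L \in [fset L in T | u \in L] by rewrite LE inE.
  rewrite !inE /= => /andP[LT uL]; split=> // L' L'T uL'.
  apply/eqP; move/fsetP: LE => /(_ L').
  by rewrite !inE /= L'T uL' => <-.
- by rewrite fpowersetE; apply/fsubsetP.
- apply/forallP=> u; have [L [LT uL Lu]] := H _ (valP u).
  apply/cardfs1P; exists L; apply/fsetP=> L'; rewrite !inE /=.
  apply/andP/eqP=> [[L'T uL']|->]; last by [].
  exact: Lu.
Qed.

Lemma M0 : M fset0 = 1.
Proof.
rewrite /M (_ : tilings fset0 = [fset fset0]) ?cardfs1 //.
apply/fsetP=> T; rewrite in_fset1; apply/tilingsP/eqP => [[TR _]|->].
  apply/fsetP=> L; rewrite inE; apply/negP=> /TR /lozengesP[u [v []]].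
  by rewrite inE.
by split=> // u; rewrite inE.
Qed.

(** Adding and deleting the lozenge are inverse bijections: in a tiling of [R] that contains it, no
    other lozenge meets [u] or [v]. *)
Lemma tilings_with_lozenge (R : {fset cell}) (u v : cell) :
    u \in R -> v \in R -> share_edge u v ->
  #|` [fset T in tilings R | [fset u; v] \in T]| = M (R `\ u `\ v).
Proof.
move=> uR vR uv; set L := [fset u; v].
have uvne : u != v by apply: contraTneq uv => ->; rewrite share_edgexx.
have uL : u \in L by rewrite !inE eqxx.
have vL : v \in L by rewrite !inE eqxx orbT.
have notL T w : T \in tilings (R `\ u `\ v) -> w \in L ->
    forall L', L' \in T -> w \notin L'.
  case/tilingsP=> TR _ wL L' /TR /lozengesP[u' [v' [u'R v'R _ ->]]].
  move: wL u'R v'R; rewrite !inE.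
  case/orP=> /eqP-> /and3P[n1 n2 _] /and3P[n3 n4 _].
    by rewrite eq_sym (negPf n2) eq_sym (negPf n4).
  by rewrite eq_sym (negPf n1) eq_sym (negPf n3).
have LnT T : T \in tilings (R `\ u `\ v) -> L \notin T.
  move=> TT; apply/negP=> LT.
  by have := notL _ _ TT uL _ LT; rewrite uL.
transitivity #|` (fun T => L |` T) @` tilings (R `\ u `\ v)|; last first.
  apply: card_in_imfset => /= T1 T2 /LnT n1 /LnT n2 e; rewrite -(fsetU1K n1) -(fsetU1K n2).
  by rewrite e.
congr #|` _|; apply/fsetP=> T; rewrite in_fset [LHS]inE.
apply/andP/imfsetP => /= [[/tilingsP[TR H] LT]|[T' T'T ->]].
  exists (T `\ L); last by rewrite fsetD1K.
  have dis L' w : L' \in T -> L' != L -> w \in L -> w \notin L'.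
    move=> L'T L'L wL; apply: contra L'L => wL'.
    have wR : w \in R by move: wL; rewrite !inE => /orP[/eqP->|/eqP->].
    have [L0 [_ _ L0u]] := H w wR.
    by rewrite (L0u _ L'T wL') (L0u _ LT wL).
  apply/tilingsP; split=> [L'|w].
    rewrite in_fsetD1 => /andP[L'L L'T]; have /lozengesP := TR _ L'T.
    move=> [u' [v' [u'R v'R u'v' L'E]]]; apply/lozengesP.
    have u'L' : u' \in L' by rewrite L'E !inE eqxx.
    have v'L' : v' \in L' by rewrite L'E !inE eqxx orbT.
    exists u', v'; split=> //; rewrite !inE ?u'R ?v'R ?andbT.
      by apply/andP; split; apply: contraTneq u'L' => ->; apply: dis.
    by apply/andP; split; apply: contraTneq v'L' => ->; apply: dis.
  rewrite !inE => /and3P[wv wu wR].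
  have [L' [L'T wL' L'u]] := H _ wR.
  exists L'; split=> //.
    rewrite !inE L'T andbT; apply: contraTneq wL' => ->.
    by rewrite !inE negb_or wu wv.
  by move=> L'' /fsetD1P[_ ?]; apply: L'u.
have LnT' := LnT _ T'T; have nL := notL _ _ T'T.
have /tilingsP[TR H] := T'T; split; last by rewrite !inE eqxx.
apply/tilingsP; split=> [L'|w wR].
  rewrite in_fset1U => /orP[/eqP->|/TR/lozengesP[u' [v' [u'R v'R u'v' ->]]]].
    by apply/lozengesP; exists u, v.
  apply/lozengesP; exists u', v'; split=> //.
    by move: u'R; rewrite !inE => /and3P[].
  by move: v'R; rewrite !inE => /and3P[].
case: (boolP (w \in L)) => wL.
  exists L; split=> //; first by rewrite !inE eqxx.
  move=> L'; rewrite !inE => /orP[/eqP//|L'T] wL'.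
  by have := nL _ wL _ L'T; rewrite wL'.
have wR' : w \in R `\ u `\ v.
  by move: wL; rewrite !inE wR negb_or => /andP[-> ->].
have [L' [L'T wL' L'u]] := H _ wR'.
exists L'; split=> //; first by rewrite !inE L'T orbT.
move=> L''; rewrite !inE => /orP[/eqP-> wL''|]; last exact: L'u.
by rewrite wL'' in wL.
Qed.

(** Every tiling has exactly one lozenge through [u]; the sum counts pairs of a tiling and a partner
    of [u] in the other order. Together with [M0], this recursion is the only access to tilings in
    what follows. *)
Lemma M_expand (R : {fset cell}) (u : cell) : u \in R ->
  M R = \sum_(v <- R | share_edge u v) M (R `\ u `\ v).
Proof.
move=> uR.
transitivity (\sum_(v <- R | share_edge u v)
    #|` [fset T in tilings R | [fset u; v] \in T]|); last first.
  rewrite big_seq_cond [RHS]big_seq_cond; apply: eq_bigr => v /andP[vR uv].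
  exact: tilings_with_lozenge.
transitivity (\sum_(v <- R | share_edge u v)
    \sum_(T <- tilings R | [fset u; v] \in T) 1); last first.
  apply: eq_bigr => v _; rewrite card_fset_sum1.
  by rewrite big_fset_condE.
rewrite /M card_fset_sum1.
under [RHS]eq_bigr do rewrite big_mkcond.
rewrite exchange_big; apply: eq_big_seq => T /tilingsP[TR H] /=.
have [L [LT uL Lu]] := H _ uR.
have [v [vR uv LE]] : exists v, [/\ v \in R, share_edge u v & L = [fset u; v]].
  have /lozengesP[u' [v' [u'R v'R u'v' LE]]] := TR _ LT.
  move: uL; rewrite LE !inE => /orP[/eqP->|/eqP->].
    by exists v'.
  by exists u'; rewrite share_edgeC fsetUC.
rewrite big_mkcond (big_fsetD1 v vR) /= uv -LE LT big1_seq ?addn0 //= => w.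
rewrite in_fsetD1 => /andP[wv wR]; case: ifP => // uw; case: ifP => // wT.
have := Lu _ wT; rewrite fset21 => /(_ isT) E.
have : w \in L by rewrite -E fset22.
rewrite LE !inE (negPf wv) orbF => /eqP wu.
by rewrite wu share_edgexx in uw.
Qed.

Local Opaque M.

Lemma M_isolated (R : {fset cell}) (u : cell) :
  u \in R -> (forall w, w \in R -> ~~ share_edge u w) -> M R = 0.
Proof.
move=> uR iso; rewrite (M_expand uR) big1_seq // => w /andP[uw /iso].
by rewrite uw.
Qed.

Lemma M_forced (R : {fset cell}) (u v : cell) :
    u \in R -> v \in R -> share_edge u v ->
    (forall w, w \in R -> share_edge u w -> w = v) ->
  M R = M (R `\ u `\ v).
Proof.
move=> uR vR uv only; rewrite (M_expand uR) big_mkcond (big_fsetD1 v vR) /= uv.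
rewrite big1_seq ?addn0 //= => w; rewrite in_fsetD1 => /andP[wv wR].
by case: ifP => // /(only _ wR) wE; rewrite wE eqxx in wv.
Qed.

Lemma eq_sum_fset (T : choiceType) (A B : {fset T}) (P Q : pred T) (F G : T -> nat) :
    (forall v, (v \in A) && P v = (v \in B) && Q v) ->
    (forall v, v \in A -> P v -> F v = G v) ->
  \sum_(v <- A | P v) F v = \sum_(v <- B | Q v) G v.
Proof.
move=> PQ FG; rewrite big_seq_cond (eq_bigr G) => [|v /andP[]]; last exact: FG.
rewrite -big_seq_cond big_fset_condE [RHS]big_fset_condE; congr bigop.body.
by congr enum_fset; apply/fsetP=> v; rewrite !in_fset !inE.
Qed.

Definition remove (I : finType) (f : I -> cell) (S : {set I}) (A : {fset cell})
  : {fset cell} :=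
  [fset u in A | ~~ [exists i in S, u == f i]].

Lemma in_remove I f S A u :
  (u \in @remove I f S A) = (u \in A) && ~~ [exists i in S, u == f i].
Proof. by rewrite /remove in_fset inE. Qed.

(** * Tilings of a region cut along pairwise disjoint crossing lozenges *)

Section Cut.

Variables (I : finType) (f f' : I -> cell) (PA PB : pred cell).
Hypothesis f_inj : injective f.
Hypothesis f'_inj : injective f'.
Hypothesis PA_PB : forall a, PA a -> PB a -> False.
Hypothesis cut_edges : forall a b, PA a -> PB b -> share_edge a b ->
  exists i, a = f i /\ b = f' i.
Hypothesis cut_edge : forall i, PA (f i) -> PB (f' i) ->
  share_edge (f i) (f' i).

Let ok (A B : {fset cell}) (S : {set I}) : bool :=
  [forall i in S, (f i \in A) && (f' i \in B)].

(** [S] records which crossing lozenges, with cells [f i] and [f' i], a tiling uses. Induction on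
    the cells of [A], expanding at a cell [u]: its partners in [A] account for the [S] that keep
    [u], its only possible partner in [B] for the [S] that remove it. [PA] and [PB] stay fixed while
    [A] and [B] shrink, so the hypotheses on the cut survive the induction. *)
Lemma M_cut (A B : {fset cell}) :
    {in A, forall a, PA a} -> {in B, forall b, PB b} ->
  M (A `|` B) =
  \sum_(S : {set I} | ok A B S) M (remove f S A) * M (remove f' S B).
Proof.
have [n] := ubnP #|` A|; elim: n A B => // n IHn A B; rewrite ltnS => leAn AP BP.
have [A0|[u uA]] := fset_0Vmem A.
  rewrite A0 fset0U (bigD1 set0) /=; last first.
    by apply/forall_inP => i; rewrite inE.
  rewrite big1 ?addn0 => [|S /andP[/forall_inP okS /set0Pn[i /okS]]].
    2: by rewrite inE.
  rewrite (_ : remove f set0 fset0 = fset0) ?M0 ?mul1n; last first.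
    by apply/fsetP=> w; rewrite in_remove inE.
  congr M; apply/fsetP=> w; rewrite in_remove; case: (w \in B) => //=.
  by apply/esym/existsPn => i; rewrite inE.
have PAu := AP _ uA.
have AD1 (C : {fset cell}) : {in A `\ u `\` C, forall a, PA a}.
  by move=> a; rewrite !inE => /and3P[_ _ /AP].
have cardD (C : {fset cell}) : #|` A `\ u `\` C| < n.
  rewrite (leq_trans _ leAn) // (cardfsD1 u A) uA add1n ltnS.
  by rewrite fsubset_leq_card // fsubsetDl.
have uB : u \notin B by apply/negP=> /BP; apply: PA_PB.
rewrite (M_expand (u := u)) ?inE ?uA //.
have -> : \sum_(v <- A `|` B | share_edge u v) M ((A `|` B) `\ u `\ v) =
  \sum_(v <- A | share_edge u v) M ((A `\ u `\ v) `|` B) +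
  \sum_(v <- B | share_edge u v) M ((A `\ u) `|` (B `\ v)).
  rewrite (bigID (mem A)) /=; congr (_ + _); apply: eq_sum_fset => v.
  - by rewrite !inE; case: (v \in A); rewrite ?andbF ?andbT.
  - rewrite !inE => _ /andP[uv vA]; congr M; apply/fsetP=> w.
    rewrite !inE; have [->|] := eqVneq w u; first by rewrite (negPf uB) !andbF.
    move=> _; have [->|] := eqVneq w v => //.
    by apply/esym/negP=> /BP; apply: PA_PB (AP _ _).
  - rewrite !inE; case: (boolP (v \in A)) => vA; last by rewrite andbT.
    rewrite !andbF; case: (boolP (v \in B)) => // vB.
    by case: (PA_PB (AP _ vA) (BP _ vB)).
  - rewrite !inE => _ /andP[uv /negPf vA]; congr M; apply/fsetP=> w.
    rewrite !inE; have [->|] := eqVneq w u; first by rewrite (negPf uB) !andbF.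
    by move=> _; have [->|] := eqVneq w v; rewrite ?vA.
pose hit (S : {set I}) w := [exists i in S, w == f i].
have okD1 S v :
    ok (A `\ u `\ v) B S = [&& ok A B S, ~~ hit S u & ~~ hit S v].
  apply/forall_inP/and3P => [okS|[/forall_inP okS uS vS] i iS].
    split; first by apply/forall_inP=> i /okS; rewrite !inE => /andP[/and3P[_ _ ->]].
      apply/exists_inP=> [[i /okS]]; rewrite !inE => /andP[/and3P[_ ne _] _].
      by rewrite eq_sym (negPf ne).
    apply/exists_inP=> [[i /okS]]; rewrite !inE => /andP[/and3P[ne _ _] _].
    by rewrite eq_sym (negPf ne).
  have /andP[fA fB] := okS _ iS; rewrite !inE fA fB !andbT.
  apply/andP; split.
    by apply: contra vS => /eqP e; apply/exists_inP; exists i; rewrite ?e.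
  by apply: contra uS => /eqP e; apply/exists_inP; exists i; rewrite ?e.
rewrite [RHS](bigID (fun S => ~~ hit S u)) /=; congr (_ + _).
  transitivity (\sum_(S | ok A B S && ~~ hit S u)
     \sum_(v <- A | share_edge u v && ~~ hit S v)
        M (remove f S (A `\ u `\ v)) * M (remove f' S B)); last first.
    apply: eq_bigr => S /andP[okS uS].
    rewrite (M_expand (R := remove f S A) (u := u)); last by rewrite in_remove uA.
    rewrite big_distrl /=; apply: eq_sum_fset => v.
      rewrite in_remove -!andbA; congr (_ && _); exact: andbC.
    move=> vA /andP[uv vS]; congr (M _ * _); apply/fsetP=> w.
    rewrite !(in_remove, in_fsetD1) -!andbA.
    by case: (w == u); case: (w == v).
  rewrite (exchange_big_dep (fun v => share_edge u v)) /=; last first.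
    by move=> S v _ /andP[].
  rewrite big_seq_cond [RHS]big_seq_cond; apply: eq_bigr => v /andP[vA uv].
  rewrite (IHn (A `\ u `\ v) B (cardD _) (AD1 _) BP).
  by apply: eq_bigl => S; rewrite okD1 uv -!andbA.
(* If [u] is no [f i], it has no neighbour in [B] and no [S] removes it, so both sums vanish. *)
case: (pickP (fun i => u == f i)) => [i0 /eqP uE | none]; last first.
  rewrite big1_seq => [|v /andP[uv vB]].
    rewrite big1 // => S /andP[_]; rewrite negbK => /exists_inP[i _].
    by rewrite none.
  have [i [uE _]] := cut_edges PAu (BP _ vB) uv.
  by have := none i; rewrite uE eqxx.
have hitE S : hit S u = (i0 \in S).
  apply/exists_inP/idP => [[i iS]|i0S]; last by exists i0 => //; rewrite uE.
  by rewrite uE => /eqP/f_inj->.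
case: (boolP (f' i0 \in B)) => vB; last first.
  rewrite big1_seq => [|v /andP[uv vB']].
    rewrite big1 // => S /andP[/forall_inP okS]; rewrite negbK hitE => /okS.
    by rewrite (negPf vB) andbF.
  have [i [iE vE]] := cut_edges PAu (BP _ vB') uv.
  have i0E : i0 = i by apply: f_inj; rewrite -uE.
  by rewrite i0E -vE vB' in vB.
have uf : share_edge u (f' i0).
  by rewrite uE; apply: cut_edge; rewrite -?uE //; apply: BP.
rewrite big_mkcond (big_fsetD1 _ vB) /= uf big1_seq ?addn0; last first.
  move=> v /andP[_]; rewrite in_fsetD1 => /andP[vne vB']; case: ifP => // uv.
  have [i [iE vE]] := cut_edges PAu (BP _ vB') uv.
  have i0E : i0 = i by apply: f_inj; rewrite -uE.
  by rewrite i0E -vE eqxx in vne.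
have E : A `\ u = A `\ u `\` fset0 by apply/fsetP=> w; rewrite !inE.
rewrite E IHn // -?E; last by move=> b; rewrite !inE => /andP[_ /BP].
(* Inserting [i0] turns the sets allowed after deleting [u] and its partner into the allowed sets
   that contain [i0]. *)
rewrite [RHS](reindex_onto (fun S => i0 |: S) (fun S => S :\ i0)) /=; last first.
  by move=> S /andP[_]; rewrite negbK hitE => /setD1K.
apply: eq_big => [S|S okS].
  rewrite negbK hitE setU11 andbT; apply/forall_inP/andP.
    move=> okS; split.
      apply/forall_inP=> i /setU1P[->|/okS]; first by rewrite vB -uE uA.
      by rewrite !inE => /andP[/andP[_ ->] /andP[_ ->]].
    apply/eqP/setP=> i; rewrite !inE; have [->|//] := eqVneq i i0.
    apply/esym/negP=> /okS; rewrite uE !inE eqxx //.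
  move=> [/forall_inP okS /eqP SE] i iS; have: i \in i0 |: S by rewrite !inE iS orbT.
  move=> /okS; rewrite !inE => /andP[-> ->]; rewrite !andbT uE.
  have ne : i != i0 by apply: contraTneq iS => ->; rewrite -SE !inE eqxx.
  by rewrite (inj_eq f_inj) (inj_eq f'_inj) ne.
have existsU (h : I -> cell) w : [exists i in i0 |: S, w == h i] =
    (w == h i0) || [exists i in S, w == h i].
  apply/exists_inP/orP.
    by move=> [i /setU1P[->|iS] e]; [left|right; apply/exists_inP; exists i].
  by move=> [e|/exists_inP[i iS e]]; [exists i0|exists i]; rewrite // !inE ?eqxx ?iS ?orbT.
congr (M _ * M _); apply/fsetP=> w; rewrite !(in_remove, in_fsetD1) existsU negb_or.
  by rewrite -uE andbA; congr (_ && _); apply: andbC.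
by rewrite andbA; congr (_ && _); apply: andbC.
Qed.

End Cut.

(** Expansion at a cell commutes with an injection preserving adjacency. This is what allows the
    lower half to be reflected. *)
Lemma M_map (f : cell -> cell) (R : {fset cell}) :
    {in R &, injective f} ->
    {in R &, forall u v, share_edge (f u) (f v) = share_edge u v} ->
  M (f @` R) = M R.
Proof.
have [n] := ubnP #|` R|; elim: n R => // n IHn R; rewrite ltnS => leRn f_inj f_edge.
have [->|[u uR]] := fset_0Vmem R; first by rewrite imfset0.
rewrite (M_expand uR) (M_expand (u := f u)); last by apply/imfsetP; exists u.
have fR : perm_eq (f @` R) (map f R) by apply: enum_imfset.
rewrite (perm_big _ fR) big_map.
apply: eq_sum_fset => v; first by case: (boolP (v \in R)) => //= vR; rewrite f_edge.
move=> vR; rewrite (f_edge _ _ uR vR) => uv.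
have sub : {subset R `\ u `\ v <= R}.
  by move=> w; rewrite !inE => /and3P[].
have IH : M (f @` (R `\ u `\ v)) = M (R `\ u `\ v).
  apply: IHn.
  - rewrite (leq_trans _ leRn) // (cardfsD1 u R) uR add1n ltnS.
    by rewrite fsubset_leq_card // fsubsetDl.
  - by move=> w w' /sub wR /sub w'R; apply: f_inj.
  - by move=> w w' /sub wR /sub w'R; apply: f_edge.
rewrite -IH; congr M; apply/fsetP=> w; rewrite !in_fsetD1; apply/idP/imfsetP => /=.
  case/and3P=> wv wu /imfsetP[w' /= w'R wE]; exists w' => //.
  rewrite !inE w'R andbT wE in wv wu *.
  by apply/andP; split; [apply: contraNneq wv => ->|apply: contraNneq wu => ->].
move=> [w']; rewrite !inE => /and3P[w'v w'u w'R] ->.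
rewrite in_imfset //= andbT.
by apply/andP; split; [apply: contraNneq w'v|apply: contraNneq w'u];
  move=> /f_inj->.
Qed.

Lemma M_expand_down (R : {fset cell}) (i j : nat) : (false, (i, j)) \in R ->
  M R = \sum_(v <- [:: (true, (i, j)); (true, (i.+1, j)); (true, (i, j.+1))]
          | v \in R) M (R `\ (false, (i, j)) `\ v).
Proof.
move=> uR; rewrite (M_expand uR) -!(big_filter _ (fun v => v \in R)) -big_filter.
apply: perm_big; apply: uniq_perm.
- exact: filter_uniq (fset_uniq _).
- by rewrite filter_uniq //= !inE !xpair_eqE; lia.
move=> [b [i' j']]; rewrite !mem_filter share_edgeE andbC.
congr (_ && _); rewrite !inE !xpair_eqE /adjacent_up_down; case: b => //=; lia.
Qed.

(** * Forced matchings in the bottom row of a region *)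

Definition row_cells (j : nat) (us ds : seq nat) : {fset cell} :=
  [fset u in [seq (true, (i, j)) | i <- us] ++ [seq (false, (i, j)) | i <- ds]].

Lemma in_row_cells j us ds (b : bool) (i j' : nat) :
  ((b, (i, j')) \in row_cells j us ds) =
  (j' == j) && (i \in if b then us else ds).
Proof.
rewrite !inE /=; apply/orP/andP => [[]/mapP[k kP [-> -> ->]] //|[/eqP->]].
by case: b => iP; [left|right]; apply/mapP; exists i.
Qed.

(** The first up-pointing cell has no neighbour below or on its left, so it is matched with the
    down-pointing cell on its right; the next one is then in the same situation. *)
Lemma M_forced_right (j a n : nat) (A : {fset cell}) :
    {in A, forall u, j <= u.2.2} ->
    (forall b i, a <= i < a + n -> (b, (i, j)) \notin A) ->
    (forall i, i.+1 = a -> (false, (i, j)) \notin A) ->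
  M (row_cells j (iota a n) (iota a n) `|` A) = M A.
Proof.
elim: n a A => [|n IHn] a A Arow Adis Aleft.
  congr M; apply/fsetP=> -[b [i j']]; rewrite !(in_fsetU, in_row_cells).
  by case: b; rewrite in_nil andbF.
rewrite (@M_forced _ (true, (a, j)) (false, (a, j))).
- rewrite -(IHn a.+1 A) //; first last.
  + by move=> i [->]; apply: Adis; lia.
  + by move=> b i ai; apply: Adis; lia.
  congr M; apply/fsetP=> -[b [i j']].
  rewrite !(in_fsetD1, in_fsetU, in_row_cells) !xpair_eqE.
  case: (boolP ((b, (i, j')) \in A)) => [iA|_].
    rewrite !orbT !andbT; have : ~~ ((i == a) && (j' == j)).
      by apply: contraTN iA => /andP[/eqP-> /eqP->]; apply: Adis; lia.
    by lia.
  by case: b; rewrite !mem_iota; lia.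
- by rewrite in_fsetU in_row_cells mem_iota eqxx /=; apply/orP; left; lia.
- by rewrite in_fsetU in_row_cells mem_iota eqxx /=; apply/orP; left; lia.
- by rewrite share_edgeE /adjacent_up_down !eqxx.
move=> [b [i j']]; rewrite in_fsetU in_row_cells share_edgeE /adjacent_up_down.
case: b => // /orP[|iA].
  by rewrite mem_iota => H1 H2; congr (_, (_, _)); lia.
case/or3P=> /andP[/eqP e1 /eqP e2].
- by rewrite e1 e2.
- by have := Aleft _ e1; rewrite -e2 iA.
- by have /= := Arow _ iA; rewrite -e2; lia.
Qed.

(** Mirror image of [M_forced_right]: the last up-pointing cell must be matched to its left, so
    pairs are removed from the right end. *)
Lemma M_forced_left (j a n : nat) (A : {fset cell}) :
    {in A, forall u, j <= u.2.2} ->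
    (forall i, a <= i < a + n -> (true, (i.+1, j)) \notin A) ->
    (forall i, a <= i <= a + n -> (false, (i, j)) \notin A) ->
  M (row_cells j (iota a.+1 n) (iota a n) `|` A) = M A.
Proof.
elim: n A => [|n IHn] A Arow Aup Adown.
  congr M; apply/fsetP=> -[b [i j']]; rewrite !(in_fsetU, in_row_cells).
  by case: b; rewrite in_nil andbF.
rewrite (@M_forced _ (true, ((a + n).+1, j)) (false, (a + n, j))).
- rewrite -(IHn A) //; first last.
  + by move=> i ai; apply: Adown; lia.
  + by move=> i ai; apply: Aup; lia.
  congr M; apply/fsetP=> -[b [i j']].
  rewrite !(in_fsetD1, in_fsetU, in_row_cells) !xpair_eqE.
  case: (boolP ((b, (i, j')) \in A)) => [iA|_].
    rewrite !orbT !andbT; case: b iA => iA; rewrite /= ?andbT.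
      by apply: contraTN iA => /andP[/eqP-> /eqP->]; apply: Aup; lia.
    by apply: contraTN iA => /andP[/eqP-> /eqP->]; apply: Adown; lia.
  by case: b; rewrite !mem_iota; lia.
- by rewrite in_fsetU in_row_cells mem_iota eqxx /=; apply/orP; left; lia.
- by rewrite in_fsetU in_row_cells mem_iota eqxx /=; apply/orP; left; lia.
- by rewrite share_edgeE /adjacent_up_down !eqxx orbT.
move=> [b [i j']]; rewrite in_fsetU in_row_cells share_edgeE /adjacent_up_down.
case: b => // /orP[|iA].
  by rewrite mem_iota => H1 H2; congr (_, (_, _)); lia.
case/or3P=> /andP[/eqP e1 /eqP e2].
- by have /negP[] : (false, (i, j')) \notin A by rewrite e1 e2; apply: Adown; lia.
- by case: e1 => <-; rewrite e2.
- by have /= := Arow _ iA; rewrite -e2; lia.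
Qed.

(** Expansion at the leftmost down-pointing cell. If it is matched upwards, the rest of the segment
    is settled by [M_forced_right]; if it is matched to its right, a segment shorter by one
    remains. *)
Lemma M_segment (j a n : nat) (A : {fset cell}) :
    {in A, forall u, j <= u.2.2} ->
    (forall i, a <= i <= (a + n).+1 -> (true, (i, j)) \notin A) ->
    (forall i, a <= i <= a + n -> (false, (i, j)) \notin A) ->
  M (row_cells j (iota a.+1 n) (iota a n.+1) `|` A) =
  \sum_(a <= s < a + n.+1 | (true, (s, j.+1)) \in A) M (A `\ (true, (s, j.+1))).
Proof.
elim: n a A => [|n IHn] a A Arow Aup Adown; set R := _ `|` A;
  have DR : (false, (a, j)) \in R
    by rewrite in_fsetU in_row_cells mem_iota; apply/orP; left; lia.
all: rewrite (M_expand_down DR) !big_cons big_nil.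
all: have -> : ((true, (a, j)) \in R) = false
  by rewrite in_fsetU in_row_cells (negPf (Aup _ _)) ?mem_iota; lia.
all: have -> : ((true, (a, j.+1)) \in R) = ((true, (a, j.+1)) \in A)
  by rewrite in_fsetU in_row_cells gtn_eqF ?ltnSn.
  have -> : ((true, (a.+1, j)) \in R) = false.
    by rewrite in_fsetU in_row_cells (negPf (Aup _ _)) ?in_nil; lia.
  rewrite [RHS]big_mkcond addn1 big_nat1; case: ifP => // VA.
  rewrite addn0; congr M; apply/fsetP=> -[b [i j']].
  rewrite !(in_fsetD1, in_fsetU, in_row_cells) !xpair_eqE.
  case: (boolP ((b, (i, j')) \in A)) => [iA|_].
    rewrite !orbT !andbT; case: b iA => iA; first by lia.
    have : ~~ ((i == a) && (j' == j)); last by lia.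
    by apply: contraTN iA => /andP[/eqP-> /eqP->]; apply: Adown; lia.
  by case: b; rewrite ?in_nil ?mem_iota; lia.
have -> : ((true, (a.+1, j)) \in R) = true.
  by rewrite in_fsetU in_row_cells mem_iota; lia.
have -> : R `\ (false, (a, j)) `\ (true, (a.+1, j)) =
    row_cells j (iota a.+2 n) (iota a.+1 n.+1) `|` A.
  apply/fsetP=> -[b [i j']].
  rewrite !(in_fsetD1, in_fsetU, in_row_cells) !xpair_eqE.
  case: (boolP ((b, (i, j')) \in A)) => [iA|_].
    rewrite !orbT !andbT; case: b iA => iA.
      have : ~~ ((i == a.+1) && (j' == j)); last by lia.
      by apply: contraTN iA => /andP[/eqP-> /eqP->]; apply: Aup; lia.
    have : ~~ ((i == a) && (j' == j)); last by lia.
    by apply: contraTN iA => /andP[/eqP-> /eqP->]; apply: Adown; lia.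
  by case: b; rewrite !mem_iota; lia.
rewrite IHn; first last.
- by move=> i ai; apply: Adown; lia.
- by move=> i ai; apply: Aup; lia.
- exact: Arow.
rewrite [RHS]big_mkcond big_ltn; last lia.
rewrite -big_mkcond addSnnS addnC; congr (_ + _); rewrite addn0.
case: ifP => // VA.
rewrite -(@M_forced_right j a.+1 n.+1 (A `\ (true, (a, j.+1)))).
- congr M; apply/fsetP=> -[b [i j']].
  rewrite !(in_fsetD1, in_fsetU, in_row_cells) !xpair_eqE.
  case: (boolP ((b, (i, j')) \in A)) => [iA|_].
    rewrite !orbT !andbT; case: b iA => iA.
      by rewrite mem_iota; lia.
    rewrite mem_iota.
    have : ~~ ((i == a) && (j' == j)).
      by apply: contraTN iA => /andP[/eqP-> /eqP->]; apply: Adown; lia.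
    by lia.
  by case: b; rewrite !mem_iota; lia.
- by move=> u; rewrite in_fsetD1 => /andP[_ /Arow].
- move=> b i ai; rewrite in_fsetD1 negb_and orbC; apply/orP; left.
  by case: b; [apply: Aup|apply: Adown]; lia.
- by move=> i [->]; rewrite in_fsetD1 negb_and orbC Adown //; lia.
Qed.

(** * Dented trapezoids *)

(* Up-pointing trapezoid with lower left vertex (i0, q), lower base w and height
   h; it is cut off at its apex if h > w. *)
Definition trapezoid (i0 q w h : nat) : {fset cell} :=
  [fset u in [seq (b, ij) | b <- [:: true; false],
                            ij <- [seq (i, j) | i <- iota i0 w, j <- iota q h]] |
    u.2.1 + u.2.2 + (if u.1 then 1 else 2) <= i0 + q + w].

Lemma in_trapezoid i0 q w h (b : bool) (i j : nat) :
  ((b, (i, j)) \in trapezoid i0 q w h) =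
  [&& i0 <= i, q <= j < q + h & i + j + (if b then 1 else 2) <= i0 + q + w].
Proof.
rewrite in_fset inE; apply/andP/and3P.
  case=> /allpairsP[[b' ij] /= [_ /allpairsP[[i' j'] /= [i'P j'P ->]] [_ -> ->]]].
  by move: i'P j'P; rewrite !mem_iota => /andP[? ?] ? ?; split.
case=> i0i qj le; split=> //; apply/allpairsP; exists (b, (i, j)); split=> //=.
  by case: b {le}.
apply/allpairsP; exists (i, j); split=> //=; rewrite mem_iota //.
by move: le; case: b; lia.
Qed.

Definition dented_trapezoid (i0 q w h : nat) (P : seq nat) : {fset cell} :=
  [fset u in trapezoid i0 q w h | ~~ [&& u.1, u.2.2 == q & u.2.1 \in P]].

Lemma in_dented_trapezoid i0 q w h P (b : bool) (i j : nat) :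
  ((b, (i, j)) \in dented_trapezoid i0 q w h P) =
  ((b, (i, j)) \in trapezoid i0 q w h) && ~~ [&& b, j == q & i \in P].
Proof. by rewrite in_fset inE. Qed.

(** The lists summed over, with one entry in each interval [p <= s < p'] between consecutive entries
    of [P], are the possible next rows of a Gelfand-Tsetlin pattern. The inner recursion keeps the
    first entry apart because each interval needs two consecutive entries. The value at [[::]] is a
    dummy. *)
Fixpoint interlacing_sum (V : nmodType) (F : seq nat -> V) (P : seq nat) : V :=
  match P with
  | [::] => 0%R
  | p :: P' =>
      (fix isum F p P' : V :=
        if P' is p' :: P'' then
          (\sum_(p <= s < p') isum (fun l => F (s :: l)) p' P'')%R
        else F [::]) F p P'
  end.

Lemma interlacing_sum2 (V : nmodType) (F : seq nat -> V) p p' P :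
  interlacing_sum F [:: p, p' & P] =
  (\sum_(p <= s < p') interlacing_sum (fun l => F (s :: l)) (p' :: P))%R.
Proof. by []. Qed.

Lemma interlacing_sum1 (V : nmodType) (F : seq nat -> V) p :
  interlacing_sum F [:: p] = F [::].
Proof. by []. Qed.

Arguments interlacing_sum : simpl never.

Lemma eq_interlacing_sum (V : nmodType) (F G : seq nat -> V) p P :
    sorted ltn (p :: P) ->
    (forall l, sorted ltn l -> all (fun s => p <= s < last p P) l ->
       size l = size P -> F l = G l) ->
  interlacing_sum F (p :: P) = interlacing_sum G (p :: P).
Proof.
elim: P p F G => [|p' P IHP] p F G sP FG; first exact: FG.
case/andP: sP => pp' sP; rewrite !interlacing_sum2.
apply: eq_big_nat => s /andP[ps sp'].
have p'P : p' <= last p' P.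
  elim: P p' {IHP FG pp' sp'} sP => //= a P IHP p' /andP[p'a aP].
  by rewrite (leq_trans (ltnW p'a)) // IHP.
apply: (IHP p') => // l sl lP szl; apply: FG => /=; last by rewrite szl.
  rewrite path_sortedE; last exact: ltn_trans.
  by rewrite sl andbT; apply/allP=> t /(allP lP); lia.
apply/andP; split; first by lia.
by apply/allP=> t /(allP lP); lia.
Qed.

(** Deleting one cell at a time follows the nesting of [interlacing_sum]. A missing cell gives 0
    because the lozenge that should cover it does not fit into the region. *)
Fixpoint M_without_ups (j : nat) (A : {fset cell}) (l : seq nat) : nat :=
  if l is s :: l' then
    if (true, (s, j)) \in A then M_without_ups j (A `\ (true, (s, j))) l' else 0
  else M A.

Lemma M_without_upsE j A l : uniq l ->
  M_without_ups j A l =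
  if all (fun s => (true, (s, j)) \in A) l
  then M [fset u in A | ~~ [&& u.1, u.2.2 == j & u.2.1 \in l]] else 0.
Proof.
elim: l A => [|s l IHl] A /=.
  move=> _; congr M; apply/fsetP=> -[b [i j']].
  by rewrite in_fset inE /= in_nil !andbF andbT.
case/andP=> sl ul; case: (boolP (_ \in A)) => //= sA; rewrite IHl //.
have -> : all (fun s0 => (true, (s0, j)) \in A `\ (true, (s, j))) l =
          all (fun s0 => (true, (s0, j)) \in A) l.
  apply: eq_in_all => t tl; rewrite in_fsetD1 !xpair_eqE !eqxx andbT /=.
  by have -> : t != s by apply: contraTneq tl => ->.
case: ifP => // _; congr M; apply/fsetP=> -[b [i j']].
rewrite !in_fset !inE /= !xpair_eqE.
case: (_ \in A); rewrite ?andbF ?andbT //=.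
by case: b; case: (j' == j); case: (i == s).
Qed.

(* The dents p < p' < .. split the row into segments; between two consecutive
   dents there is one more down-pointing cell than up-pointing ones, so exactly
   one of them, at an arbitrary position s, is matched with the row above, and
   the rest of the segment is then forced. *)
Lemma M_dented_row (j e p : nat) (P : seq nat) (A : {fset cell}) :
    {in A, forall u, j < u.2.2} ->
    sorted ltn (p :: P) -> last p P < e ->
  M (row_cells j [seq i <- iota p.+1 (e - p.+1) | i \notin P]
                 (iota p (e - p.+1)) `|` A) =
  interlacing_sum (M_without_ups j.+1 A) (p :: P).
Proof.
elim: P p A => [|p' P IHP] p A Arow /= sP Pe.
  (* To the right of the last dent the row has equally many cells of both kinds, and they all pair
     off within the row. *)
  rewrite (_ : [seq i <- _ | _] = iota p.+1 (e - p.+1)); last first.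
    by apply/all_filterP/allP.
  by apply: M_forced_left => [u /Arow/ltnW|i _|i _] //; apply/negP=> /Arow /=; lia.
move: sP => /andP[pp' sP].
have p'P : {in P, forall t, p' < t}.
  move: sP; rewrite path_sortedE; last exact: ltn_trans.
  by case/andP=> /allP.
have p'e : p' < e.
  case: (P) p'P Pe => //= t P' p'P; apply: leq_ltn_trans.
  by apply/ltnW/p'P; rewrite mem_last.
(* The part of the row beyond the dent [p'] is counted with [A], so that [M_segment] sees the single
   segment between [p] and [p']. *)
set A' := row_cells j [seq i <- iota p'.+1 (e - p'.+1) | i \notin P]
                 (iota p' (e - p'.+1)) `|` A.
have -> : row_cells j [seq i <- iota p.+1 (e - p.+1) | i \notin p' :: P]
     (iota p (e - p.+1)) `|` A =
   row_cells j (iota p.+1 (p' - p.+1)) (iota p (p' - p.+1).+1) `|` A'.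
  apply/fsetP=> -[b [i j']]; rewrite !(in_fsetU, in_row_cells).
  case: (_ \in A); rewrite ?orbT ?orbF //.
  case: b; last by rewrite !mem_iota; lia.
  rewrite !mem_filter !mem_iota inE negb_or.
  case: (boolP (i \in P)) => [/p'P|_]; lia.
rewrite M_segment; first last.
- move=> i ai; rewrite in_fsetU in_row_cells mem_iota negb_or; apply/andP; split; first lia.
  by apply/negP=> /Arow /=; lia.
- move=> i ai; rewrite in_fsetU in_row_cells mem_filter mem_iota negb_or.
  apply/andP; split; first lia.
  by apply/negP=> /Arow /=; lia.
- move=> [b [i j']]; rewrite in_fsetU in_row_cells => /orP[/andP[/eqP-> _] //|].
  by move/Arow/ltnW.
rewrite interlacing_sum2 big_mkcond.
have -> : p + (p' - p.+1).+1 = p' by lia.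
apply: eq_big_nat => s /andP[ps sp'].
rewrite in_fsetU in_row_cells gtn_eqF ?ltnSn // orFb.
case: (boolP (_ \in A)) => sA; last first.
  have E0 : interlacing_sum (fun=> 0) (p' :: P) = 0 :> nat.
    elim: (P) (p') => // a P' IH b; rewrite interlacing_sum2 big1 // => ? _; exact: IH.
  rewrite -E0; apply: eq_interlacing_sum => // l _ _ _ /=.
  by rewrite (negPf sA).
have E : A' `\ (true, (s, j.+1)) =
  row_cells j [seq i <- iota p'.+1 (e - p'.+1) | i \notin P]
                 (iota p' (e - p'.+1)) `|` (A `\ (true, (s, j.+1))).
  apply/fsetP=> -[b [i j']]; rewrite !(in_fsetU, in_row_cells, in_fsetD1).
  rewrite !xpair_eqE; case: (_ \in A); rewrite ?andbF ?andbT ?orbT ?orbF.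
    by case: (boolP (j' == j)) => [/eqP->|_]; rewrite ?orbF; lia.
  by case: (boolP (j' == j)) => [/eqP->|_]; rewrite ?andbF //; lia.
rewrite E IHP //; last by move=> u; rewrite in_fsetD1 => /andP[_ /Arow].
by apply: eq_interlacing_sum => // l _ _ _ /=; rewrite sA.
Qed.

Lemma eq_interlacing_sum1 (V : nmodType) (F G : seq nat -> V) P :
  F =1 G -> interlacing_sum F P = interlacing_sum G P.
Proof.
case: P => // p P; elim: P p F G => [|p' P IHP] p F G FG.
  by rewrite !interlacing_sum1.
by rewrite !interlacing_sum2; apply: eq_bigr => s _; apply: IHP => l; apply: FG.
Qed.

Lemma interlacing_sumM (R : pzSemiRingType) (c : R) F p P :
  (interlacing_sum (fun l => c * F l) (p :: P) =
   c * interlacing_sum F (p :: P))%R.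
Proof.
elim: P p F => // p' P IHP p F; rewrite !interlacing_sum2 big_distrr /=.
by apply: eq_bigr => s _; apply: IHP.
Qed.

Lemma interlacing_sum_sum (V : nmodType) (I : finType) (F : I -> seq nat -> V) p P :
  (interlacing_sum (fun l => \sum_i F i l) (p :: P) =
   \sum_i interlacing_sum (F i) (p :: P))%R.
Proof.
elim: P p F => // p' P IHP p F; rewrite !interlacing_sum2.
under [RHS]eq_bigr do rewrite interlacing_sum2.
by rewrite exchange_big; apply: eq_bigr => s _; apply: IHP.
Qed.

Lemma natr_interlacing_sum (R : pzRingType) (F : seq nat -> nat) p P :
  ((interlacing_sum F (p :: P))%:R =
   interlacing_sum (fun l => (F l)%:R) (p :: P) :> R)%R.
Proof.
elim: P p F => // p' P IHP p F; rewrite !interlacing_sum2 natr_sum.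
by apply: eq_bigr => s _; apply: IHP.
Qed.

(** Applied to each term of the Leibniz formula, this moves an interlacing sum inside a
    determinant. *)
Lemma interlacing_sum_prod (R : comPzRingType) p P (G : nat -> nat -> R) :
  (interlacing_sum (fun l => \prod_(i < size P) G i (nth 0%N l i)) (p :: P) =
   \prod_(i < size P)
     \sum_(nth 0%N (p :: P) i <= s < nth 0%N (p :: P) i.+1) G i s)%R.
Proof.
elim: P p G => [|p' P IHP] p G; first by rewrite interlacing_sum1 !big_ord0.
rewrite interlacing_sum2 [RHS]big_ord_recl /= big_distrl /=.
apply: eq_bigr => s _; rewrite -(IHP p' (fun i => G i.+1)) -interlacing_sumM.
by apply: eq_interlacing_sum1 => l; rewrite big_ord_recl.
Qed.

(** * Summing Vandermonde determinants over interlacing lists *)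

Lemma ffact_telescope (s j : nat) :
  (((s.+1 ^_ j.+1)%:R - (s ^_ j.+1)%:R) = j.+1%:R * (s ^_ j)%:R :> rat)%R.
Proof.
rewrite ffactSS ffactnSr; have [js|sj] := leqP j s; last first.
  by rewrite ffact_small // muln0 mul0n subr0 mulr0.
by rewrite !natrM natrB // -!natr1; ring.
Qed.

Lemma sum_ffact (a b j : nat) : a <= b ->
  (j.+1%:R * \sum_(a <= s < b) (s ^_ j)%:R =
   (b ^_ j.+1)%:R - (a ^_ j.+1)%:R :> rat)%R.
Proof.
move=> ab; rewrite big_distrr /= -(telescope_sumr (fun s => (s ^_ j.+1)%:R)%R ab).
by apply: eq_bigr => s _; rewrite ffact_telescope.
Qed.

(** A Vandermonde matrix in falling factorials instead of powers. The determinant is the same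
    ([det_ffact_mx]), while the sum of an entry over an integer interval is, up to the factor
    [j.+1], an exact difference of entries one degree higher ([sum_ffact]). *)
Definition ffact_mx (l : seq nat) : 'M[rat]_(size l) :=
  (\matrix_(i, j) (nth 0%N l i ^_ j)%:R)%R.

Lemma det_ffact_mx_diff p P :
  (\det (ffact_mx (p :: P)) =
   \det (\matrix_(i < size P, j < size P)
      ((nth 0%N (p :: P) i.+1 ^_ j.+1)%:R - (nth 0%N (p :: P) i ^_ j.+1)%:R)))%R.
Proof.
set B := ffact_mx _; set n := size P.
(* Multiplication by this unitriangular matrix subtracts from each row the previous one. The first
   column, constantly 1, becomes a unit vector, along which the determinant is expanded. *)
pose L : 'M[rat]_n.+1 := (\matrix_(i, k) ((i == k)%:R - (i == k.+1 :> nat)%:R))%R.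
have detL : (\det L = 1)%R.
  rewrite det_trig; first by rewrite big1 // => i _; rewrite mxE eqxx ltn_eqF // subr0.
  apply/is_trig_mxP => i k ik; rewrite mxE.
  by rewrite (ltn_eqF (leq_trans ik (leqnSn k))) -val_eqE /= (ltn_eqF ik) subrr.
rewrite -[LHS]mul1r -{1}detL -det_mulmx (expand_det_col _ ord0) big_ord_recl.
have LB0 j : ((L *m B) ord0 j = B ord0 j)%R.
  rewrite mxE (bigD1 ord0) //= big1 ?addr0 => [|k k0].
    by rewrite mxE eqxx subr0 mul1r.
  by rewrite mxE eq_sym (negPf k0) subrr mul0r.
have LBS (i : 'I_n) j : ((L *m B) (lift ord0 i) j =
    B (lift ord0 i) j - B (widen_ord (leqnSn n) i) j)%R.
  rewrite mxE (bigD1 (lift ord0 i)) //= (bigD1 (widen_ord (leqnSn n) i)) /=; last first.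
    by rewrite -val_eqE /= /bump /= add1n ltn_eqF.
  rewrite big1 ?addr0 => [|k /andP[k1 k2]].
    rewrite !mxE eqxx /= !eqxx -val_eqE /= /bump /= add1n.
    by rewrite (gtn_eqF (ltnSn i)) (ltn_eqF (ltnSn i.+1)) subr0 sub0r mul1r mulN1r.
  rewrite mxE eq_sym (negPf k1) /= /bump /= add1n eqSS eq_sym.
  by move: k2; rewrite -val_eqE /= => /negPf->; rewrite subrr mul0r.
rewrite big1 ?addr0 => [|i _]; last first.
  by rewrite LBS !mxE !ffactn0 subrr mul0r.
rewrite LB0 mxE ffactn0 mul1r /cofactor addn0 expr0 mul1r.
congr (\det _)%R; apply/matrixP=> i j.
by rewrite [LHS]mxE [LHS]mxE LBS !mxE.
Qed.

Lemma interlacing_sum_det p P : sorted ltn (p :: P) ->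
  ((size P)`!%:R * interlacing_sum
     (fun l => \det (\matrix_(i < size P, j < size P) (nth 0%N l i ^_ j)%:R)) (p :: P)
   = \det (ffact_mx (p :: P)) :> rat)%R.
Proof.
move=> sP; rewrite det_ffact_mx_diff.
set n := size P.
(* Row [i] involves only the [i]-th summation variable, so by multilinearity the sum passes to the
   entries. *)
pose A : 'M[rat]_n := (\matrix_(i, j)
  \sum_(nth 0%N (p :: P) i <= s < nth 0%N (p :: P) i.+1) (s ^_ j)%:R)%R.
have -> : (interlacing_sum
    (fun l => \det (\matrix_(i < n, j < n) (nth 0%N l i ^_ j)%:R) : rat)
    (p :: P) = \det A)%R.
  rewrite /determinant interlacing_sum_sum; apply: eq_bigr => sg _.
  rewrite interlacing_sumM; congr (_ * _)%R.
  under [RHS]eq_bigr do rewrite mxE.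
  (* [interlacing_sum_prod] takes factors indexed by [nat]; the column chosen outside ['I_n] is
     arbitrary. *)
  pose G (i s : nat) : rat := (s ^_ (if insub i is Some i' then (sg : {perm 'I_n}) i' else 0%N))%:R%R.
  transitivity (interlacing_sum (fun l => \prod_(i < n) G i (nth 0%N l i))%R (p :: P)).
    apply: eq_interlacing_sum1 => l; apply: eq_bigr => i _.
    by rewrite mxE /G valK.
  rewrite interlacing_sum_prod; apply: eq_bigr => i _; apply: eq_bigr => s _.
  by rewrite /G valK.
(* The factorial is the determinant of a diagonal matrix that gives column [j] the factor [j.+1]
   required by [sum_ffact]. *)
rewrite fact_prod big_add1 big_mkord natr_prod.
rewrite -[X in (X * _)%R](_ : \det (diag_mx (\row_(j < n) j.+1%:R)) = _)%R; last first.
  by rewrite det_diag; apply: eq_bigr => j _; rewrite mxE.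
rewrite mulrC -det_mulmx; congr (\det _)%R; apply/matrixP=> i j.
rewrite mul_mx_diag !mxE mulrC sum_ffact //.
apply/ltnW/(sorted_ltn_nth ltn_trans) => //; rewrite inE /=; have := ltn_ord i; lia.
Qed.

(** Absolute differences keep the product in [nat] and independent of the order of the list, so
    dents can be listed fern by fern. *)
Fixpoint vandermonde (l : seq nat) : nat :=
  if l is p :: l' then (\prod_(t <- l') `|p - t|) * vandermonde l' else 1.

Lemma natr_vandermonde l : sorted ltn l ->
  ((vandermonde l)%:R =
   \prod_(i < size l) \prod_(j < size l | (i < j)%N)
     ((nth 0%N l j)%:R - (nth 0%N l i)%:R) :> rat)%R.
Proof.
elim: l => [|p l IHl] sl; first by rewrite big_ord0.
move: sl; rewrite /= (path_sortedE ltn_trans) => /andP[/allP lp sl].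
rewrite natrM IHl // big_ord_recl; congr (_ * _)%R.
  rewrite [in RHS]big_mkcond [in RHS]big_ord_recl /= mul1r natr_prod (big_nth 0%N) big_mkord.
  apply: eq_bigr => i _; have pi : p < nth 0 l i by apply: lp; rewrite mem_nth.
  by rewrite distnC distnEl ?natrB // ltnW.
apply: eq_bigr => i _; rewrite big_mkcond.
by rewrite [in RHS]big_mkcond [in RHS]big_ord_recl /= mul1r.
Qed.

Lemma ffact_horner (p j : nat) :
  ((p ^_ j)%:R = (\prod_(k < j) ('X - k%:R%:P)).[p%:R] :> rat)%R.
Proof.
elim: j => [|j IHj]; first by rewrite big_ord0 hornerC ffactn0.
rewrite ffactnSr big_ord_recr /= hornerM -IHj hornerXsubC.
have [jp|pj] := leqP j p; first by rewrite natrM natrB.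
by rewrite ffact_small // mul0r.
Qed.

(** The falling factorial of degree [j] is a monic polynomial of degree [j], so the change of basis
    [C] from powers is unitriangular. *)
Lemma det_ffact_mx l : sorted ltn l ->
  (\det (ffact_mx l) = (vandermonde l)%:R)%R.
Proof.
move=> sl; rewrite natr_vandermonde //; set n := size l.
pose a : 'rV[rat]_n := (\row_i (nth 0%N l i)%:R)%R.
transitivity (\det (Vandermonde n a))%R; last first.
  by rewrite det_Vandermonde; apply: eq_bigr => i _; apply: eq_bigr => j _; rewrite !mxE.
pose f (j : nat) : {poly rat} := (\prod_(k < j) ('X - k%:R%:P))%R.
have size_f j : size (f j) = j.+1.
  rewrite /f -(big_mkord xpredT (fun k => 'X - k%:R%:P)%R).
  by rewrite size_prod_XsubC size_iota subn0.
have monic_f j : f j \is monic by apply: monic_prod_XsubC.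
pose C : 'M[rat]_n := (\matrix_(j, k) (f j)`_k)%R.
have detC : (\det C = 1)%R.
  rewrite det_trig; first rewrite big1 // => i _.
    by rewrite mxE; move/monicP: (monic_f i); rewrite lead_coefE size_f.
  by apply/is_trig_mxP=> i k ik; rewrite mxE nth_default ?size_f.
rewrite -[RHS]mul1r -{1}detC -det_mulmx -det_tr; congr (\det _)%R.
apply/matrixP=> j i; rewrite !mxE ffact_horner -/(f j).
rewrite (@horner_coef_wide _ n) ?size_f //; apply: eq_bigr => k _.
by rewrite !mxE.
Qed.

Lemma interlacing_sum_vandermonde p P : sorted ltn (p :: P) ->
  (size P)`! * interlacing_sum vandermonde (p :: P) = vandermonde (p :: P).
Proof.
move=> sP; apply/eqP; rewrite -(eqr_nat rat); apply/eqP.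
rewrite natrM natr_interlacing_sum -det_ffact_mx // -interlacing_sum_det //.
congr (_ * _)%R; apply: eq_interlacing_sum => // l sl _ <-.
by rewrite -det_ffact_mx.
Qed.

Lemma vandermonde_insert l1 p l2 :
  vandermonde (l1 ++ p :: l2) = (\prod_(t <- l1 ++ l2) `|p - t|) * vandermonde (l1 ++ l2).
Proof.
elim: l1 => //= s l1 ->; rewrite /= !(big_cat, big_cons) /= distnC.
by ring.
Qed.

Lemma perm_vandermonde l l' : perm_eq l l' -> vandermonde l = vandermonde l'.
Proof.
elim: l l' => [|p l IHl] l'; first by rewrite perm_sym => /perm_nilP->.
move=> pl; have pl' : p \in l' by rewrite -(perm_mem pl) inE eqxx.
case/splitPr: pl' pl => l1 l2; rewrite perm_sym -cat1s perm_catCA /= perm_cons perm_sym.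
move=> pl; rewrite vandermonde_insert /= (perm_big _ pl) /=.
by rewrite (IHl _ pl).
Qed.

Lemma vandermonde_cat l1 l2 :
  vandermonde (l1 ++ l2) =
  vandermonde l1 * vandermonde l2 * \prod_(s <- l1) \prod_(t <- l2) `|s - t|.
Proof.
elim: l1 => [|p l1 IHl] /=; first by rewrite big_nil muln1 mul1n.
rewrite IHl !(big_cat, big_cons) /=.
by ring.
Qed.

Lemma vandermonde_shift d l : vandermonde (map (addn d) l) = vandermonde l.
Proof.
elim: l => //= p l ->; congr (_ * _); rewrite big_map.
by apply: eq_bigr => t _; rewrite distnDl.
Qed.

Lemma hyperfactS n : hyperfact n.+1 = hyperfact n * n`!.
Proof. exact: big_ord_recr. Qed.

Lemma trapezoidS i0 q w h : 0 < w ->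
  trapezoid i0 q w h.+1 =
  row_cells q (iota i0 w) (iota i0 w.-1) `|` trapezoid i0 q.+1 w.-1 h.
Proof.
move=> w0; apply/fsetP=> -[b [i j]].
by rewrite in_fsetU in_row_cells !in_trapezoid; case: b; rewrite mem_iota; lia.
Qed.

(** Induction on the height: the bottom row passes its dents on to an interlacing list with one
    entry less, and [interlacing_sum_vandermonde] evaluates the sum. At [h = 0] the region is empty
    and has one tiling whatever [P] is, so the last hypothesis restricts that case to the empty
    list. *)
Lemma M_dented_trapezoid_sorted i0 q w h P :
    h <= w -> sorted ltn P -> all (fun p => i0 <= p < i0 + w) P ->
    (0 < h) || nilp P ->
  M (dented_trapezoid i0 q w h P) * hyperfact h =
  if size P == h then vandermonde P else 0.
Proof.
elim: h q w P => [|h IHh] q w P hw sP inP.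
  case: P {sP inP} => // _; rewrite /= /hyperfact big_ord0 muln1.
  rewrite (_ : dented_trapezoid _ _ _ _ _ = fset0) ?M0 //.
  apply/fsetP=> -[b [i j]]; rewrite in_dented_trapezoid in_trapezoid inE; lia.
move=> _; set A := trapezoid i0 q.+1 w.-1 h.
have Arow : {in A, forall u : cell, q < u.2.2}.
  by move=> [b [i j]]; rewrite in_trapezoid /=; lia.
case: P sP inP => [|p P] sP inP.
  (* Without dents the bottom row has one more up-pointing than down-pointing cell; pairing from the
     left leaves the last one isolated. *)
  rewrite (_ : M _ = 0) //.
  pose B := row_cells q [:: i0 + w.-1] [::] `|` A.
  have BE b i j : ((b, (i, j)) \in B) =
      [&& b, j == q & i == i0 + w.-1] || ((b, (i, j)) \in A).
    by rewrite in_fsetU in_row_cells; case: b; rewrite !inE ?andbF.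
  transitivity (M B).
    rewrite -(@M_forced_right q i0 w.-1 B).
    - congr M; apply/fsetP=> -[b [i j]]; rewrite in_dented_trapezoid in_nil !andbF andbT.
      rewrite trapezoidS; last lia.
      rewrite !(in_fsetU, in_row_cells) orbA; congr (_ || _).
      by case: b; rewrite ?inE !mem_iota; lia.
    - by move=> [b [i j]]; rewrite BE => /orP[|/Arow/ltnW //] /and3P[_ /eqP->].
    - move=> b i ai; rewrite BE negb_or; apply/andP; split; first lia.
      by apply/negP=> /Arow /=; lia.
    - move=> i ai; rewrite BE; apply/negP=> /Arow /=; lia.
  apply: (@M_isolated _ (true, (i0 + w.-1, q))); first by rewrite BE !eqxx.
  move=> [b [i j]]; rewrite BE share_edgeE /adjacent_up_down.
  case: b => //=; move=> jA; have /= := Arow _ jA.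
  by move: jA; rewrite in_trapezoid; lia.
have [ip pw] : i0 <= p /\ p < i0 + w by case/andP: inP => /andP[].
have lastP : last p P < i0 + w.
  by have /allP/(_ (last p P)) := inP; rewrite mem_last => /(_ isT); lia.
have -> : M (dented_trapezoid i0 q w h.+1 (p :: P)) =
    interlacing_sum (M_without_ups q.+1 A) (p :: P).
  rewrite -(@M_dented_row _ (i0 + w)) //; set B := _ `|` A.
  have lP t : t \in P -> p < t.
    by move: sP; rewrite /= (path_sortedE ltn_trans) => /andP[/allP lP _] /lP.
  rewrite -(@M_forced_right q i0 (p - i0) B).
  - congr M; apply/fsetP=> -[b [i j]]; rewrite in_dented_trapezoid trapezoidS; last lia.
    rewrite !(in_fsetU, in_row_cells).
    case: (boolP (_ \in A)) => [/Arow /=|_]; first by rewrite !orbT /=; lia.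
    rewrite !orbF; case: b; last by rewrite !mem_iota; lia.
    rewrite inE mem_filter !mem_iota.
    by case: (boolP (i \in P)) => [/lP|_]; lia.
  - move=> [b [i j]]; rewrite in_fsetU in_row_cells => /orP[/andP[/eqP->]//|].
    by move/Arow/ltnW.
  - move=> b i ai; rewrite in_fsetU in_row_cells negb_or.
    apply/andP; split; last by apply/negP=> /Arow /=; lia.
    by case: b; rewrite ?mem_filter !mem_iota; lia.
  - move=> i ai; rewrite in_fsetU in_row_cells mem_iota negb_or.
    by apply/andP; split; [lia|apply/negP=> /Arow /=; lia].
have ltA l : sorted ltn l -> all (fun s => p <= s < last p P) l ->
    all (fun s => i0 <= s < i0 + w.-1) l.
  by move=> _ lP; apply/allP=> s /(allP lP); lia.
have term l : sorted ltn l -> all (fun s => p <= s < last p P) l ->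
    size l = size P ->
  hyperfact h * M_without_ups q.+1 A l = if size P == h then vandermonde l else 0.
  move=> sl lP szl; rewrite M_without_upsE ?(sorted_uniq ltn_trans ltnn) //.
  (* The induction hypothesis does not cover height 0 with a nonempty [l]; there the value is 0
     because the region above the row is empty. *)
  have [h0|h0] := posnP h.
    have A0 : A = fset0.
      by apply/fsetP=> -[b [i j]]; rewrite in_trapezoid inE h0; lia.
    rewrite -szl; case: l {sl lP szl} => [|s l]; last first.
      by rewrite A0 /= muln0 h0.
    rewrite h0 /= /hyperfact big_ord0 mul1n -M0; congr M.
    by apply/fsetP=> u; rewrite in_fset inE A0 in_fset0.
  rewrite -(szl) -(IHh q.+1 w.-1 l) ?ltA ?h0 //; last lia.
  rewrite mulnC; case: ifP => [//|/negP[]].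
  apply/allP=> s /(allP (ltA _ sl lP)) ; rewrite in_trapezoid; lia.
rewrite mulnC hyperfactS.
have -> : hyperfact h * h`! * interlacing_sum (M_without_ups q.+1 A) (p :: P) =
    h`! * interlacing_sum (fun l => if size P == h then vandermonde l else 0) (p :: P).
  rewrite [_ * h`!]mulnC -mulnA; congr (_ * _).
  transitivity (interlacing_sum
    (fun l => hyperfact h * M_without_ups q.+1 A l) (p :: P)).
    exact/esym/(interlacing_sumM (R := nat)).
  exact: eq_interlacing_sum.
rewrite eqSS; case: (size P =P h) => [<-|_].
  exact: interlacing_sum_vandermonde.
rewrite (_ : interlacing_sum _ _ = 0) ?muln0 //.
elim: {1}P p {sP inP ip pw lastP ltA term} => // p1 P1 IH p0.
by rewrite interlacing_sum2 big1 // => s _; apply: IH.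
Qed.

Lemma eq_dented_trapezoid i0 q w h P P' :
  P =i P' -> dented_trapezoid i0 q w h P = dented_trapezoid i0 q w h P'.
Proof.
move=> PP'; apply/fsetP=> -[b [i j]].
rewrite !in_dented_trapezoid; congr (_ && ~~ [&& _, _ & _]); exact: PP'.
Qed.

Lemma M_dented_trapezoid i0 q w h P :
    h <= w -> uniq P -> all (fun p => i0 <= p < i0 + w) P ->
    (0 < h) || nilp P ->
  M (dented_trapezoid i0 q w h P) * hyperfact h =
  if size P == h then vandermonde P else 0.
Proof.
move=> hw uP inP hP; pose P' := sort leq P.
have PP' : perm_eq P P' by rewrite perm_sym perm_sort.
rewrite (eq_dented_trapezoid _ _ _ _ (perm_mem PP')) (perm_vandermonde PP').
rewrite (perm_size PP') M_dented_trapezoid_sorted //.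
- by rewrite ltn_sorted_uniq_leq sort_uniq uP sort_sorted //; apply: leq_total.
- by rewrite -(perm_all _ PP').
- by rewrite /nilp -(perm_size PP').
Qed.

(** * Ferns *)

Lemma in_triangle_up p q t b i j :
  in_triangle true (p, q) t (b, (i, j)) =
  [&& p <= i, q <= j & i + j + (if b then 1 else 2) <= p + q + t].
Proof. by rewrite /in_triangle; case: b => /=; lia. Qed.

Lemma in_triangle_down p q t b i j :
  in_triangle false (p, q) t (b, (i, j)) =
  [&& p + q <= i + j + (if b then 0 else 1), i < p + t & j < q].
Proof. by rewrite /in_triangle; case: b => /=; lia. Qed.

Lemma in_filter_fset (R : {fset cell}) (P : pred cell) (u : cell) :
  (u \in [fset v in R | P v]) = (u \in R) && P u.
Proof. by rewrite in_fset inE. Qed.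

(* Once the base cells of the triangle are removed, its down-pointing cells are
   forced, row by row, to be matched upwards. *)
Lemma M_triangle_hole p q t (R : {fset cell}) :
    (forall u, in_triangle true (p, q) t u -> u \in R) ->
  M [fset u in R | ~~ in_triangle true (p, q) t u] =
  M [fset u in R | ~~ [&& u.1, u.2.2 == q & p <= u.2.1 < p + t]].
Proof.
elim: t q R => [|t IHt] q R triR.
  congr M; apply/fsetP=> -[b [i j]]; rewrite !in_filter_fset in_triangle_up /=.
  by congr (_ && ~~ _); case: b; lia.
(* The region left after the first [k] down-pointing cells of row [q] have been matched upwards. For
   [k = t], all that is missing above row [q] is the base of a triangle of side [t]. *)
pose X k := [fset u in R | ~~ [|| [&& u.1, u.2.2 == q & p <= u.2.1 < p + t.+1],
   [&& ~~ u.1, u.2.2 == q & p <= u.2.1 < p + k]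
   | [&& u.1, u.2.2 == q.+1 & p <= u.2.1 < p + k]]].
have MX k : k <= t -> M (X 0) = M (X k).
  elim: k => // k IHk kt; rewrite IHk; last exact: ltnW.
  rewrite (@M_forced _ (false, (p + k, q)) (true, (p + k, q.+1))).
  - congr M; apply/fsetP=> -[b [i j]].
    rewrite !in_fsetD1 !in_filter_fset !xpair_eqE /=.
    by case: (_ \in R); rewrite ?andbF //; case: b; lia.
  - by rewrite in_filter_fset triR ?in_triangle_up //=; lia.
  - by rewrite in_filter_fset triR ?in_triangle_up //=; lia.
  - by rewrite share_edgeE /adjacent_up_down !eqxx !orbT.
  move=> [b [i j]]; rewrite in_filter_fset share_edgeE /adjacent_up_down /=.
  by case: b => // /andP[_ H1] H2; congr (_, (_, _)); lia.
pose R1 := [fset u in R | ~~ (in_triangle true (p, q) t.+1 u && (u.2.2 == q))].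
transitivity (M [fset u in R1 | ~~ in_triangle true (p, q.+1) t u]).
  congr M; apply/fsetP=> -[b [i j]]; rewrite !in_filter_fset !in_triangle_up /=.
  by case: (_ \in R) => //; case: b; lia.
rewrite IHt; last first.
  move=> [b [i j]] iT; rewrite in_filter_fset triR /=.
    by move: iT; rewrite !in_triangle_up; lia.
  by move: iT; rewrite !in_triangle_up; lia.
transitivity (M (X t)).
  congr M; apply/fsetP=> -[b [i j]]; rewrite !in_filter_fset in_triangle_up /=.
  by case: (_ \in R) => //; case: b; lia.
rewrite -MX //; congr M; apply/fsetP=> -[b [i j]]; rewrite !in_filter_fset /=.
by case: (_ \in R) => //; case: b; lia.
Qed.

(** Seen from above its line, a fern acts only through the base cells of its up-pointing triangles
    ([M_fern]); seen from below, through those of the other triangles, whence the flag [up]. *)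
Fixpoint fern_ups (up : bool) (p : nat) (t : seq nat) : seq nat :=
  if t is t1 :: t' then
    (if up then iota p t1 else [::]) ++ fern_ups (~~ up) (p + t1) t'
  else [::].

Lemma in_fern_cat up p q s t u :
  in_fern up (p, q) (s ++ t) u =
  in_fern up (p, q) s u || in_fern (up (+) odd (size s)) (p + sumn s, q) t u.
Proof.
elim: s up p => [|s1 s IHs] up p /=; first by rewrite addn0 addbF.
by rewrite IHs orbA addnA addbN addNb.
Qed.

Lemma fern_ups_cat up p s t :
  fern_ups up p (s ++ t) =
  fern_ups up p s ++ fern_ups (up (+) odd (size s)) (p + sumn s) t.
Proof.
elim: s up p => [|s1 s IHs] up p /=; first by rewrite addn0 addbF.
by rewrite IHs catA addnA addbN addNb.
Qed.

Lemma osum_cons t1 t : osum (t1 :: t) = t1 + esum t.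
Proof.
rewrite /osum /esum big_mkcond big_ord_recl /=; congr (_ + _).
by rewrite [RHS]big_mkcond; apply: eq_bigr => i _; rewrite negbK.
Qed.

Lemma esum_cons t1 t : esum (t1 :: t) = osum t.
Proof.
rewrite /osum /esum big_mkcond big_ord_recl /= add0n.
by rewrite [RHS]big_mkcond.
Qed.

Lemma osum_nil : osum [::] = 0. Proof. by rewrite /osum big_ord0. Qed.
Lemma esum_nil : esum [::] = 0. Proof. by rewrite /esum big_ord0. Qed.

Lemma osumDesum t : osum t + esum t = sumn t.
Proof.
elim: t => [|t1 t IHt]; first by rewrite osum_nil esum_nil.
by rewrite osum_cons esum_cons -addnA [esum t + _]addnC IHt.
Qed.

Lemma size_fern_ups up p t :
  size (fern_ups up p t) = if up then osum t else esum t.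
Proof.
elim: t up p => [|t1 t IHt] up p /=; first by rewrite osum_nil esum_nil if_same.
by rewrite size_cat IHt osum_cons esum_cons; case: up => //=; rewrite size_iota.
Qed.

Lemma mem_fern_ups up p t i : i \in fern_ups up p t -> p <= i < p + sumn t.
Proof.
elim: t up p => //= t1 t IHt up p; rewrite mem_cat => /orP[|/IHt]; last lia.
by case: up; rewrite ?in_nil // mem_iota; lia.
Qed.

Lemma fern_ups_uniq up p t : uniq (fern_ups up p t).
Proof.
elim: t up p => //= t1 t IHt up p; rewrite cat_uniq IHt andbT.
apply/andP; split; first by case: up; rewrite ?iota_uniq.
apply/hasPn => i /mem_fern_ups ip; case: up; rewrite ?in_nil //= mem_iota; lia.
Qed.

Lemma fern_ups_shift d up p t :
  fern_ups up (d + p) t = map (addn d) (fern_ups up p t).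
Proof.
elim: t up p => //= t1 t IHt up p; rewrite map_cat -IHt addnA.
by case: up => //; rewrite iotaDl.
Qed.

(** Each triangle is a dent on exactly one side of the line, so the dents of both sides fill the
    segment of the fern. This makes their union independent of the individual sides. *)
Lemma perm_fern_ups p t :
  perm_eq (fern_ups true p t ++ fern_ups false p t) (iota p (sumn t)).
Proof.
elim: t p => //= t1 t IHt p; rewrite iotaD -catA perm_cat2l.
by rewrite perm_catC.
Qed.

Lemma in_fern_above up p q t b i j :
    in_fern up (p, q) t (b, (i, j)) -> q <= j ->
  [/\ p <= i, i + j + (if b then 1 else 2) <= p + q + sumn t
    & j < q + (if up then osum t else esum t)].
Proof.
elim: t up p => //= t1 t IHt up p; rewrite osum_cons esum_cons => /orP[|].
  move=> {IHt}; case: up; rewrite ?in_triangle_up ?in_triangle_down;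
  by case: b => /and3P[*]; split; lia.
move=> /IHt H /H[h1 h2 h3]; split; try lia.
by case: up h3 {H} => /=; lia.
Qed.

(** The up-pointing triangles are replaced one by one by their bases. Above the line the rest of the
    fern has first coordinate at least [p + t1], hence is disjoint from the current triangle. *)
Lemma M_fern p q up t (R : {fset cell}) :
    (forall u, u \in R -> q <= u.2.2) ->
    (forall u, in_fern up (p, q) t u -> q <= u.2.2 -> u \in R) ->
  M [fset u in R | ~~ in_fern up (p, q) t u] =
  M [fset u in R | ~~ [&& u.1, u.2.2 == q & u.2.1 \in fern_ups up p t]].
Proof.
elim: t up p R => [|t1 t IHt] up p R Rrow tR.
  congr M; apply/fsetP=> u; rewrite !in_filter_fset; case: (_ \in R) => //=.
  by rewrite in_nil !andbF.
have rest_col b i j : in_fern (~~ up) (p + t1, q) t (b, (i, j)) -> q <= j ->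
    p + t1 <= i by move=> H1 H2; case: (in_fern_above H1 H2).
case: up tR rest_col => tR rest_col; last first.
  transitivity (M [fset u in R | ~~ in_fern true (p + t1, q) t u]).
    congr M; apply/fsetP=> -[b [i j]]; rewrite !in_filter_fset.
    case: (boolP (_ \in R)) => // /Rrow /= qj; rewrite in_triangle_down.
    by rewrite [j < q]ltnNge qj !andbF.
  by rewrite IHt // => u ut; apply: tR; rewrite /= ut orbT.
pose R' := [fset u in R | ~~ in_fern false (p + t1, q) t u].
transitivity (M [fset u in R' | ~~ in_triangle true (p, q) t1 u]).
  congr M; apply/fsetP=> u; rewrite !in_filter_fset negb_or -andbA.
  by congr (_ && _); rewrite andbC.
rewrite M_triangle_hole; last first.
  move=> [b [i j]] ut; have := ut; rewrite in_triangle_up => /and3P[pi qj ij].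
  rewrite in_filter_fset tR /= ?ut //=.
  by apply/negP=> /rest_col /(_ qj); move: ij; case: b {ut}; lia.
pose R2 := [fset u in R | ~~ [&& u.1, u.2.2 == q & p <= u.2.1 < p + t1]].
transitivity (M [fset u in R2 | ~~ in_fern false (p + t1, q) t u]).
  congr M; apply/fsetP=> u; rewrite !in_filter_fset -!andbA.
  by congr (_ && _); rewrite andbC.
rewrite IHt.
- congr M; apply/fsetP=> -[b [i j]]; rewrite !in_filter_fset -andbA /=.
  congr (_ && _); rewrite mem_cat mem_iota.
  by case: b; case: (j == q) => //=; rewrite negb_or.
- by move=> u; rewrite in_filter_fset => /andP[/Rrow].
move=> [b [i j]] ut qj; rewrite in_filter_fset tR //= ?ut ?orbT //=.
by have := rest_col _ _ _ ut qj; lia.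
Qed.

Lemma in_hexagon n ne se s sw nw (b : bool) (i j : nat) :
  ((b, (i, j)) \in hexagon n ne se s sw nw) =
  [&& sw <= i + j + (if b then 0 else 1),
      i + j + (if b then 1 else 2) <= sw + s + se, i < sw + s & j < sw + nw].
Proof.
rewrite in_fset inE; apply/andP/and4P => [[_]|[h1 h2 h3 h4]].
  by case: b => /=; move=> H; split; lia.
split; last by case: b h1 h2 => /=; lia.
apply/allpairsP; exists (b, (i, j)); split=> //=; first by case: b {h1 h2}.
by apply/allpairsP; exists (i, j); split=> //=; rewrite mem_iota; lia.
Qed.

(** No cell lies below level 0, so the gaps between dents can be read as down-pointing triangles
    without cells. *)
Lemma in_dentsE p t u : in_dents (p, 0) t u = in_fern true (p, 0) t u.
Proof.
have tri0 p' t' : in_triangle false (p', 0) t' u = false.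
  by case: u => b [i j]; rewrite in_triangle_down ltn0 !andbF.
have [n] := ubnP (size t); elim: n t p => // n IHn [|t1 [|t2 t]] p //=.
  by rewrite orbF.
by move=> nt; rewrite IHn ?tri0 //; lia.
Qed.

Lemma semihex_vandermonde t :
  semihex t * hyperfact (osum t) = vandermonde (fern_ups true 0 t).
Proof.
have := @M_dented_trapezoid 0 0 (sumn t) (osum t) (fern_ups true 0 t).
rewrite size_fern_ups eqxx => <-.
- congr (_ * _); rewrite /semihex /dented_semihexagon.
  transitivity (M [fset u in trapezoid 0 0 (sumn t) (osum t)
                  | ~~ in_fern true (0, 0) t u]).
    congr M; apply/fsetP=> -[b [i j]]; rewrite [LHS]in_filter_fset.
    rewrite [RHS]in_filter_fset in_dentsE.
    by congr (_ && _); rewrite in_hexagon in_trapezoid osumDesum; case: b; lia.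
  rewrite M_fern // => -[b [i j]] ut ij.
  by have [h1 h2 h3] := in_fern_above ut ij; rewrite in_trapezoid; case: b h2 {ut ij}; lia.
- by rewrite -osumDesum leq_addr.
- exact: fern_ups_uniq.
- by apply/allP=> i /mem_fern_ups.
- by rewrite /nilp size_fern_ups; lia.
Qed.

Lemma in_fern_base up p q t i :
  in_fern up (p, q) t (true, (i, q)) = (i \in fern_ups up p t).
Proof.
elim: t up p => //= t1 t IHt up p; rewrite mem_cat IHt; congr (_ || _).
by case: up; rewrite ?in_triangle_up ?in_triangle_down ?mem_iota ?in_nil; lia.
Qed.

(** The positions [S] of crossing lozenges act as dents just like the bases of the fern, so both
    kinds together must number [h]. *)
Lemma M_half i0 q w h t S :
    h <= w -> sumn t <= w -> osum t <= h -> uniq S ->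
    (forall s, s \in S -> i0 <= s < i0 + w) ->
    (forall s, s \in S -> s \notin fern_ups true i0 t) ->
    (0 < h) || nilp S ->
  M [fset u in trapezoid i0 q w h | ~~ in_fern true (i0, q) t u
       && ~~ [&& u.1, u.2.2 == q & u.2.1 \in S]] * hyperfact h =
  if osum t + size S == h then vandermonde (fern_ups true i0 t ++ S) else 0.
Proof.
move=> hw tw th uS Sw SU hS; set U := fern_ups true i0 t.
have <- : size (U ++ S) = osum t + size S by rewrite size_cat size_fern_ups.
rewrite -(@M_dented_trapezoid i0 q w) //.
- congr (_ * _).
  pose R := [fset u in trapezoid i0 q w h | ~~ [&& u.1, u.2.2 == q & u.2.1 \in S]].
  transitivity (M [fset u in R | ~~ in_fern true (i0, q) t u]).
    congr M; apply/fsetP=> u; rewrite [LHS]in_filter_fset [RHS]in_filter_fset.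
    by rewrite [u \in R]in_filter_fset -andbA; congr (_ && _); rewrite andbC.
  rewrite M_fern.
  + congr M; apply/fsetP=> -[b [i j]]; rewrite [LHS]in_filter_fset.
    rewrite [(b, (i, j)) \in R]in_filter_fset in_dented_trapezoid -andbA.
    congr (_ && _).
    by rewrite mem_cat /=; case: b; case: (j == q) => //=; rewrite negb_or andbC.
  + move=> [b [i j]]; rewrite [_ \in R]in_filter_fset => /andP[].
    by rewrite in_trapezoid /=; lia.
  move=> [b [i j]] ut qj; rewrite [_ \in R]in_filter_fset; apply/andP; split.
    have [h1 h2 h3] := in_fern_above ut qj; rewrite in_trapezoid.
    by move: qj; case: b h2 {ut} => /=; lia.
  apply/negP=> /= /and3P[bT /eqP jq iS].
  by move: ut; rewrite bT jq in_fern_base; apply/negP/SU.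
- rewrite cat_uniq fern_ups_uniq uS andbT; apply/hasPn=> s /SU //.
- rewrite all_cat; apply/andP; split; last by apply/allP.
  by apply/allP=> i /mem_fern_ups; lia.
- move: hS; rewrite /nilp size_cat size_fern_ups; lia.
Qed.

(* Reflection of the cells below the line at level q, sending the lattice point
   (i, q) of that line to (i, 0). *)
Definition reflect_cell (q : nat) (u : cell) : cell :=
  (~~ u.1, (u.2.1 + u.2.2 + (if u.1 then 0 else 1) - q, q.-1 - u.2.2)).

Lemma M_reflect q (B : {fset cell}) :
    (forall b i j, (b, (i, j)) \in B ->
       j < q /\ q <= i + j + (if b then 0 else 1)) ->
  M (reflect_cell q @` B) = M B.
Proof.
move=> Bq; apply: M_map.
  move=> [b [i j]] [b' [i' j']] /Bq[jq qi] /Bq[jq' qi'] [bb ei ej].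
  have {}bb : b = b' by case: b b' bb {qi qi' ei} => [] [].
  by rewrite -bb in qi' ei *; congr (_, (_, _)); lia.
move=> [b [i j]] [b' [i' j']] /Bq[jq qi] /Bq[jq' qi'].
rewrite !share_edgeE /adjacent_up_down.
by case: b qi; case: b' qi' => //= qi qi'; lia.
Qed.

Lemma in_reflect q (B : {fset cell}) (b : bool) (i k : nat) :
    (forall b i j, (b, (i, j)) \in B ->
       j < q /\ q <= i + j + (if b then 0 else 1)) ->
  ((b, (i, k)) \in reflect_cell q @` B) =
  (k < q) && ((~~ b, (i + k + (if b then 0 else 1), q.-1 - k)) \in B).
Proof.
move=> Bq; apply/imfsetP/andP => /= [[[b' [i' j']] /= uB [-> -> ->]]|[kq uB]].
  have [jq qi] := Bq _ _ _ uB; split; first by lia.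
  rewrite negbK; move: uB; congr (is_true ((_, (_, _)) \in B)).
    by case: b' qi => /=; lia.
  by lia.
exists (~~ b, (i + k + (if b then 0 else 1), q.-1 - k)) => //.
by rewrite /reflect_cell /= negbK; congr (_, (_, _)); case: b {uB} => /=; lia.
Qed.

Definition ord_positions N (S : {set 'I_N}) : seq nat := [seq val i | i <- enum S].

(* The sum over the positions S of the z lozenges crossing the line, W being the
   list of all dents of the two halves. *)
Definition gap_sum (N z : nat) (G W : seq nat) : nat :=
  \sum_(S : {set 'I_N} | (#|S| == z) && [forall i in S, val i \in G])
    vandermonde (ord_positions S) ^ 2
    * \prod_(u <- W) \prod_(s <- ord_positions S) `|u - s|.

Lemma eq_gap_sum N z G W W' : perm_eq W W' -> gap_sum N z G W = gap_sum N z G W'.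
Proof.
by move=> WW'; apply: eq_bigr => S _; congr (_ * _); apply: perm_big.
Qed.

(** Both halves are given as trapezoids with ferns, the lower one after reflection and starting at
    [l]. Their heights exceed the number of fern dents by [z], so only sets [S] of size [z]
    contribute. The third hypothesis makes the subtraction in [reflect_cell] exact. *)
Lemma M_fern_line (R : {fset cell}) (q l w1 h1 w2 h2 z N : nat)
    (t1 t2 G : seq nat) :
    (forall b i j, q <= j -> ((b, (i, j)) \in R) =
       ((b, (i, j)) \in trapezoid 0 q w1 h1)
       && ~~ in_fern true (0, q) t1 (b, (i, j))) ->
    (forall b i k, k < q ->
       ((~~ b, (i + k + (if b then 0 else 1), q.-1 - k)) \in R) =
       ((b, (i, k)) \in trapezoid l 0 w2 h2)
       && ~~ in_fern true (l, 0) t2 (b, (i, k))) ->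
    (forall b i j, j < q -> (b, (i, j)) \in R ->
       q <= i + j + (if b then 0 else 1)) ->
    h1 <= w1 -> h2 <= w2 -> sumn t1 <= w1 -> sumn t2 <= w2 ->
    h1 = osum t1 + z -> h2 = osum t2 + z -> z <= q -> h2 <= q ->
    (forall i, l <= i < w1 ->
       (i \in G) = (i \notin fern_ups true 0 t1) && (i \notin fern_ups true l t2)) ->
    (forall i, i \in G -> [&& i < N, i < w1, l <= i & i < l + w2]) ->
  M R * (hyperfact h1 * hyperfact h2) =
  vandermonde (fern_ups true 0 t1) * vandermonde (fern_ups true l t2)
  * gap_sum N z G (fern_ups true 0 t1 ++ fern_ups true l t2).
Proof.
move=> Rup Rlow Rdom hw1 hw2 tw1 tw2 h1E h2E zq hq2 GE Gin.
set U := fern_ups true 0 t1; set D := fern_ups true l t2.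
pose A := [fset u in R | q <= u.2.2]; pose B := [fset u in R | u.2.2 < q].
have RAB : R = A `|` B.
  apply/fsetP=> u; rewrite in_fsetU !in_filter_fset.
  by case: (_ \in R) => //=; case: leqP.
(* The two cells of the crossing lozenge at position [i]. For [q = 0] the predecessor is a dummy,
   [B] being empty. *)
pose f (i : 'I_N) : cell := (true, (val i, q)).
pose f' (i : 'I_N) : cell := (false, (val i, q.-1)).
have upE i : ((true, (i, q)) \in A) = [&& i < w1, 0 < h1 & i \notin U].
  rewrite in_filter_fset leqnn andbT Rup // in_trapezoid in_fern_base.
  by rewrite [RHS]andbA; congr (_ && _); lia.
have downE i : 0 < q ->
    ((false, (i, q.-1)) \in B) = [&& l <= i < l + w2, 0 < h2 & i \notin D].
  move=> q0; rewrite in_filter_fset prednK // leqnn andbT.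
  have := Rlow true i 0 q0; rewrite addn0 addn0 subn0 => ->.
  by rewrite in_trapezoid in_fern_base [RHS]andbA; congr (_ && _); lia.
have Bdom b i j : (b, (i, j)) \in B -> j < q /\ q <= i + j + (if b then 0 else 1).
  by rewrite in_filter_fset => /andP[iR jq]; split=> //; apply: Rdom.
rewrite RAB (@M_cut _ f f' (fun u => u \in A) (fun u => u \in B)) //; first last.
- move=> i _; rewrite in_filter_fset => /andP[_ /= q1].
  by rewrite share_edgeE /adjacent_up_down !eqxx /= prednK ?eqxx ?orbT //; lia.
- move=> [b [i j]] [b' [i' j']] /= aA aB.
  have := aA; rewrite in_filter_fset /= => /andP[_ qj].
  have := aB; rewrite in_filter_fset /= => /andP[_ jq].
  have q0 : 0 < q by lia.
  rewrite share_edgeE /adjacent_up_down; case: b aA => aA; case: b' aB => aB //= e; last lia.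
  have [ei ej ej'] : [/\ i' = i, j = q & j' = q.-1] by split; lia.
  move: aA aB; rewrite ei ej ej' upE downE // => /and3P[i1 i2 i3] /and3P[i4 i5 i6].
  have iG : i \in G by rewrite GE; [rewrite i3 i6|lia].
  have /andP[iN _] := Gin _ iG.
  by exists (Ordinal iN).
- move=> u; rewrite in_filter_fset => /andP[_ qu].
  by rewrite in_filter_fset ltnNge qu andbF.
- by move=> i j [] /val_inj.
- by move=> i j [] /val_inj.
(* A crossing lozenge needs a row on each side of the line; this positivity is the side condition of
   [M_half] for nonempty [S]. *)
have okE (S : {set 'I_N}) :
    [forall i in S, (f i \in A) && (f' i \in B)] ->
    [forall i in S, val i \in G] /\ (S != set0 -> [&& 0 < q, 0 < h1 & 0 < h2]).
  move/forall_inP=> okS; have H i : i \in S -> [&& 0 < q, 0 < h1, 0 < h2 & val i \in G].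
    move=> /okS; rewrite upE.
    case: (posnP q) => [q0|q0]; first by rewrite in_filter_fset q0 ltn0 !andbF.
    rewrite downE // => /andP[/and3P[i1 i2 i3] /and3P[i4 i5 i6]].
    by rewrite i2 i5 GE ?i3 ?i6 // i1 andbT; case/andP: i4.
  split; first by apply/forall_inP=> i /H /and4P[].
  by case/set0Pn=> i /H /and4P[-> -> ->].
have posP (S : {set 'I_N}) s : s \in ord_positions S -> exists2 i, i \in S & s = val i.
  by case/mapP=> i; rewrite mem_enum => iS ->; exists i.
have term (S : {set 'I_N}) : [forall i in S, (f i \in A) && (f' i \in B)] ->
  M (remove f S A) * M (remove f' S B) * (hyperfact h1 * hyperfact h2) =
  if #|S| == z then vandermonde U * vandermonde D * (vandermonde (ord_positions S) ^ 2
    * \prod_(u <- U ++ D) \prod_(s <- ord_positions S) `|u - s|) else 0.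
  move=> okS; have [/forall_inP SG S0] := okE S okS.
  have uS : uniq (ord_positions S) by rewrite map_inj_uniq ?enum_uniq //; apply: val_inj.
  have szS : size (ord_positions S) = #|S| by rewrite size_map -cardE.
  have nilS : nilp (ord_positions S) = (S == set0) by rewrite /nilp szS cards_eq0.
  have SGs s : s \in ord_positions S -> s \in G by case/posP=> i /SG ? ->.
  have SUD s : s \in ord_positions S -> (s \notin U) && (s \notin D).
    by move=> /SGs sG; have /and4P[_ s1 s2 _] := Gin _ sG; rewrite -GE ?s1 ?s2.
  have -> : remove f S A = [fset u in trapezoid 0 q w1 h1 | ~~ in_fern true (0, q) t1 u
      && ~~ [&& u.1, u.2.2 == q & u.2.1 \in ord_positions S]].
    apply/fsetP=> -[b [i j]]; rewrite in_remove [RHS]in_filter_fset in_filter_fset /=.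
    have -> : [exists i0 in S, (b, (i, j)) == f i0] =
        [&& b, j == q & i \in ord_positions S].
      apply/exists_inP/and3P => [[k kS /eqP[-> -> ->]]|[bT /eqP-> /posP[k kS ->]]].
        by split=> //; apply: map_f; rewrite mem_enum.
      by exists k => //; rewrite bT.
    case: (leqP q j) => qj; first by rewrite andbT Rup // -andbA.
    by rewrite andbF in_trapezoid [q <= j]leqNgt qj !andbF.
  have -> : M (remove f' S B) = M [fset u in trapezoid l 0 w2 h2 | ~~ in_fern true (l, 0) t2 u
      && ~~ [&& u.1, u.2.2 == 0 & u.2.1 \in ord_positions S]].
    have Bdom' b i j : (b, (i, j)) \in remove f' S B ->
        j < q /\ q <= i + j + (if b then 0 else 1).
      by rewrite in_remove => /andP[/Bdom].
    rewrite -(M_reflect Bdom'); congr M; apply/fsetP=> -[b [i k]].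
    rewrite (in_reflect _ _ _ Bdom') in_remove [RHS]in_filter_fset.
    case: (ltnP k q) => kq; last first.
      by apply/esym/negP; rewrite in_trapezoid => /andP[]; lia.
    rewrite in_filter_fset /= Rlow // -!andbA; congr (_ && (_ && _)).
    have -> : q.-1 - k < q by lia.
    rewrite /=; congr (~~ _); apply/exists_inP/and3P.
      move=> [s sS /eqP[bE ei ek]]; have bT : b by case: b bE {ei}.
      have k0 : k = 0 by lia.
      rewrite k0; split=> //; apply/mapP; exists s; first by rewrite mem_enum.
      by move: ei; rewrite bT k0 !addn0.
    move=> [bT /eqP-> /posP[s sS ->]]; exists s => //.
    by rewrite bT !addn0 subn0.
  rewrite mulnACA M_half //; first last.
  - by rewrite nilS; case: eqVneq => [|/S0/and3P[_ ->]] //; rewrite orbT.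
  - by move=> s /SUD/andP[].
  - by move=> s /SGs/Gin; lia.
  - lia.
  rewrite M_half //; first last.
  - by rewrite nilS; case: eqVneq => [|/S0/and3P[_ _ ->]] //; rewrite orbT.
  - by move=> s /SUD/andP[].
  - by move=> s /SGs/Gin; lia.
  - lia.
  rewrite szS h1E h2E !eqn_add2l; case: eqP => // _.
  (* Each half contributes the Vandermonde product of [S] once, hence the square in [gap_sum]. *)
  rewrite !vandermonde_cat big_cat /=; ring.
rewrite big_distrl /=; under eq_bigr => S okS do rewrite (term S okS).
rewrite -big_mkcondr /= /gap_sum big_distrr /=; apply: eq_bigl => S.
apply/andP/andP => [[/okE[SG _] Sz]|[Sz SG]]; split=> //.
apply/forall_inP=> i iS.
have q0 : 0 < q.
  by rewrite (leq_trans _ zq) // -(eqP Sz) card_gt0; apply/set0Pn; exists i.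
have z0 : 0 < z by rewrite -(eqP Sz) card_gt0; apply/set0Pn; exists i.
have iG := forall_inP SG _ iS; have /and4P[_ g1 g2 g3] := Gin _ iG.
have := GE (val i); rewrite g1 g2 iG => /(_ isT)/esym/andP[g4 g5].
by rewrite upE downE // g1 g2 g3 g4 g5 h1E h2E !addn_gt0 z0 !orbT.
Qed.

(** * The regions of the theorem *)

Lemma osum_esum_rcons s t1 :
  osum (rcons s t1) = osum s + (if odd (size s) then 0 else t1) /\
  esum (rcons s t1) = esum s + (if odd (size s) then t1 else 0).
Proof.
elim: s => [|s1 s [IHo IHe]] /=.
  by rewrite osum_cons esum_cons osum_nil esum_nil addn0.
by rewrite !osum_cons !esum_cons IHo IHe addnA !if_neg.
Qed.

Lemma osum_esum_rev s :
  osum (rev s) = (if odd (size s) then osum s else esum s) /\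
  esum (rev s) = (if odd (size s) then esum s else osum s).
Proof.
elim: s => [|s1 s [IHo IHe]]; first by rewrite /= osum_nil esum_nil.
rewrite rev_cons /= osum_cons esum_cons.
have [-> ->] := osum_esum_rcons (rev s) s1; rewrite IHo IHe size_rev.
by case: (odd (size s)); rewrite ?addn0 // addnC.
Qed.

Lemma in_rfernE up r q b u : sumn b <= r ->
  in_rfern up (r, q) b u =
  in_fern (up (+) ~~ odd (size b)) (r - sumn b, q) (rev b) u.
Proof.
elim: b up r => //= b1 b IHb up r br.
rewrite IHb; last lia.
rewrite rev_cons -cats1 in_fern_cat size_rev sumn_rev /= orbF orbC.
have -> : r - b1 - sumn b = r - (b1 + sumn b) by lia.
have -> : r - (b1 + sumn b) + sumn b = r - b1 by lia.
by case: up; case: (odd (size b)).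
Qed.

Lemma in_fern_reflect up p q t b i k : k < q ->
  in_fern up (p, q) t (~~ b, (i + k + (if b then 0 else 1), q.-1 - k)) =
  in_fern (~~ up) (p, 0) t (b, (i, k)).
Proof.
move=> kq; elim: t up p => //= t1 t IHt up p; rewrite IHt; congr (_ || _).
by case: up; rewrite !in_triangle_up !in_triangle_down; case: b {IHt} => /=; lia.
Qed.

(** [l] is the corner triangle completing the upper half. The last triangle of [c] and the last of
    [b], the leftmost of the right fern, point down when the ferns have even length; seen from above
    they merge with the gap [g'] into one entry. *)
Definition upper_dents (l g g' : nat) (a c b : seq nat) : seq nat :=
  l :: a ++ g :: take (size c).-1 c
    ++ (last 0 c + g' + last 0 b) :: rev (take (size b).-1 b).

(** After reflection the last triangle of [a] and the first of [c] point down and merge with the gap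
    [g]; the corner triangle [r] is at the right end. *)
Definition lower_dents (r g g' : nat) (a c b : seq nat) : seq nat :=
  take (size a).-1 a ++ (last 0 a + g + head 0 c) :: behead c
    ++ g' :: rev b ++ [:: r].

Lemma rcons_of_even (s : seq nat) : 0 < size s -> ~~ odd (size s) ->
  exists s' t1, s = rcons s' t1 /\ odd (size s').
Proof.
case/lastP: s => // s t1 _; rewrite size_rcons /= negbK => os.
by exists s, t1.
Qed.

Section Dents.

Variables (l r g g' : nat) (a c b : seq nat).
Hypotheses (a_gt0 : 0 < size a) (a_even : ~~ odd (size a)).
Hypotheses (b_gt0 : 0 < size b) (b_even : ~~ odd (size b)).
Hypotheses (c_gt0 : 0 < size c) (c_even : ~~ odd (size c)).

Let Y := l + sumn a.
Let E := Y + g + sumn c + g'.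

Lemma upper_dentsE : exists c' ck b' bn,
  [/\ c = rcons c' ck, b = rcons b' bn, odd (size c'), odd (size b')
    & upper_dents l g g' a c b = l :: a ++ g :: c' ++ (ck + g' + bn) :: rev b'].
Proof.
have [c' [ck [-> oc]]] := rcons_of_even c_gt0 c_even.
have [b' [bn [-> ob]]] := rcons_of_even b_gt0 b_even.
exists c', ck, b', bn; split=> //; rewrite /upper_dents !last_rcons !size_rcons /=.
by rewrite -!cats1 !take_size_cat.
Qed.

Lemma lower_dentsE : exists a' am c1 c',
  [/\ a = rcons a' am, c = c1 :: c', odd (size a'), odd (size c')
    & lower_dents r g g' a c b =
      a' ++ (am + g + c1) :: c' ++ g' :: rev b ++ [:: r]].
Proof.
have [a' [am [-> oa]]] := rcons_of_even a_gt0 a_even.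
case: c c_gt0 c_even => // c1 c' _ /=; rewrite negbK => oc.
exists a', am, c1, c'; split=> //; rewrite /lower_dents last_rcons size_rcons /=.
by rewrite -!cats1 !take_size_cat.
Qed.

Lemma fern_ups_upper_dents :
  fern_ups true 0 (upper_dents l g g' a c b) =
  iota 0 l ++ fern_ups false l a ++ fern_ups true (Y + g) c
    ++ fern_ups false E (rev b).
Proof.
have [c' [ck [b' [bn [cE bE oc ob ->]]]]] := upper_dentsE.
rewrite /= add0n fern_ups_cat (negPf a_even) addbF /= -/Y fern_ups_cat oc /=.
rewrite bE rev_rcons /= cE -cats1 fern_ups_cat oc /= cats0.
by rewrite /E cE sumn_rcons; do 3!congr (_ ++ _); congr fern_ups; lia.
Qed.

Lemma in_fern_upper_dents q u : q <= u.2.2 ->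
  in_fern true (0, q) (upper_dents l g g' a c b) u =
  [|| in_triangle true (0, q) l u, in_fern false (l, q) a u,
      in_fern true (Y + g, q) c u | in_fern false (E, q) (rev b) u].
Proof.
move=> qu; have tri p t : in_triangle false (p, q) t u = false.
  by case: u qu => b0 [i j] /= qj; rewrite in_triangle_down [j < q]ltnNge qj !andbF.
have [c' [ck [b' [bn [cE bE oc ob ->]]]]] := upper_dentsE.
rewrite /= add0n in_fern_cat (negPf a_even) addbF /= -/Y tri in_fern_cat oc /= tri.
rewrite bE rev_rcons /= cE -cats1 in_fern_cat oc /= !tri /= orbF.
by rewrite /E cE sumn_rcons; do 3!congr (_ || _); congr in_fern; congr (_, _); lia.
Qed.

Lemma fern_ups_lower_dents :
  fern_ups true l (lower_dents r g g' a c b) =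
  fern_ups true l a ++ fern_ups false (Y + g) c
    ++ fern_ups true E (rev b) ++ iota (E + sumn b) r.
Proof.
have [a' [am [c1 [c' [aE cE oa oc ->]]]]] := lower_dentsE.
rewrite fern_ups_cat oa /= fern_ups_cat oc /= fern_ups_cat size_rev (negPf b_even) /=.
rewrite cats0 sumn_rev aE -cats1 fern_ups_cat oa /= cats0.
rewrite cE /= /E /Y aE cE sumn_rcons /=.
have -> : l + sumn a' + (am + g + c1) = l + (sumn a' + am) + g + c1 by lia.
have -> : l + (sumn a' + am) + g + c1 + sumn c' + g' =
  l + (sumn a' + am) + g + (c1 + sumn c') + g' by lia.
by [].
Qed.

Lemma in_fern_lower_dents u :
  in_fern true (l, 0) (lower_dents r g g' a c b) u =
  [|| in_fern true (l, 0) a u, in_fern false (Y + g, 0) c u,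
      in_fern true (E, 0) (rev b) u | in_triangle true (E + sumn b, 0) r u].
Proof.
have tri p t : in_triangle false (p, 0) t u = false.
  by case: u => b0 [i j]; rewrite in_triangle_down ltn0 !andbF.
have [a' [am [c1 [c' [aE cE oa oc ->]]]]] := lower_dentsE.
rewrite in_fern_cat oa /= tri in_fern_cat oc /= tri in_fern_cat size_rev (negPf b_even) /=.
rewrite orbF sumn_rev aE -cats1 in_fern_cat oa /= !tri /= orbF.
rewrite cE /= tri /E /Y aE cE sumn_rcons /=.
have -> : l + sumn a' + (am + g + c1) = l + (sumn a' + am) + g + c1 by lia.
have -> : l + (sumn a' + am) + g + c1 + sumn c' + g' =
  l + (sumn a' + am) + g + (c1 + sumn c') + g' by lia.
by [].
Qed.

Lemma osum_upper_dents :
  osum (upper_dents l g g' a c b) = l + esum a + osum c + osum b.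
Proof.
rewrite -[LHS]/(if true then _ else esum (upper_dents l g g' a c b)).
rewrite -(size_fern_ups true 0) fern_ups_upper_dents !size_cat !size_fern_ups size_iota.
by have [_ ->] := osum_esum_rev b; rewrite (negPf b_even) !addnA.
Qed.

Lemma osum_lower_dents :
  osum (lower_dents r g g' a c b) = osum a + esum c + esum b + r.
Proof.
rewrite -[LHS]/(if true then _ else esum (lower_dents r g g' a c b)).
rewrite -(size_fern_ups true l) fern_ups_lower_dents !size_cat !size_fern_ups size_iota.
by have [-> _] := osum_esum_rev b; rewrite (negPf b_even) !addnA.
Qed.

Lemma sumn_upper_dents :
  sumn (upper_dents l g g' a c b) = l + sumn a + g + sumn c + g' + sumn b.
Proof.
have [c' [ck [b' [bn [-> -> _ _ ->]]]]] := upper_dentsE.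
by rewrite /= !sumn_cat /= sumn_cat /= sumn_rev !sumn_rcons; lia.
Qed.

Lemma sumn_lower_dents :
  sumn (lower_dents r g g' a c b) = sumn a + g + sumn c + g' + sumn b + r.
Proof.
have [a' [am [c1 [c' [-> -> _ _ ->]]]]] := lower_dentsE.
by rewrite !sumn_cat /= !sumn_cat /= sumn_cat /= sumn_rev !sumn_rcons; lia.
Qed.

(** [perm_fern_ups] fills the segment of each fern, and the corners [l] and [r] prolong the outer
    ones; the hypothesis gives both outer intervals the length [Y]. *)
Lemma perm_dents : l + sumn a = sumn b + r ->
  perm_eq (fern_ups true 0 (upper_dents l g g' a c b)
             ++ fern_ups true l (lower_dents r g g' a c b))
          (iota 0 Y ++ iota (Y + g) (sumn c) ++ iota E Y).
Proof.
move=> YE; rewrite fern_ups_upper_dents fern_ups_lower_dents.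
have -> : iota 0 Y = iota 0 l ++ iota l (sumn a) by rewrite -iotaD.
have -> : iota E Y = iota E (sumn b) ++ iota (E + sumn b) r.
  by rewrite -iotaD -YE.
apply/seq.permP=> P; rewrite !count_cat.
have := seq.permP (perm_fern_ups l a) P; have := seq.permP (perm_fern_ups (Y + g) c) P.
have := seq.permP (perm_fern_ups E (rev b)) P; rewrite sumn_rev !count_cat.
lia.
Qed.

End Dents.

Definition core_intervals (Y g g' n : nat) : seq nat :=
  iota 0 Y ++ iota (Y + g) n ++ iota (Y + g + n + g') Y.

Definition core_gaps (Y g g' n : nat) : seq nat :=
  iota Y g ++ iota (Y + g + n) g'.

Lemma M_Rleft x y z a b c :
    0 < size a -> ~~ odd (size a) -> 0 < size b -> ~~ odd (size b) ->
    0 < size c -> ~~ odd (size c) ->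
  let nu := minn (sumn a) (sumn b) in
  let Y := maxn (sumn a) (sumn b) + y in
  let g := (x + z)./2 in let g' := uphalf (x + z) in
  let t1 := upper_dents (y + sumn b - nu) g g' a c b in
  let t2 := lower_dents (y + sumn a - nu) g g' a c b in
  M (Rleft x y z a c b) * (hyperfact (osum t1 + z) * hyperfact (osum t2 + z)) =
  vandermonde (fern_ups true 0 t1) * vandermonde (fern_ups true 0 t2)
  * gap_sum (Y + g + sumn c + g') z (core_gaps Y g g' (sumn c))
      (core_intervals Y g g' (sumn c)).
Proof.
move=> a0 ea b0 eb c0 ec nu Y g g'.
set l := y + sumn b - nu; set r := y + sumn a - nu; move=> t1 t2.
have gg' : g + g' = x + z by rewrite /g /g' uphalf_half -[RHS]odd_double_half; lia.
have YE : l + sumn a = Y by rewrite /l /Y /nu; lia.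
have YE' : sumn b + r = Y by rewrite /r /Y /nu; lia.
have [oea oeb oec] := And3 (osumDesum a) (osumDesum b) (osumDesum c).
have UDperm := perm_dents g g' a0 ea b0 eb c0 ec (etrans YE (esym YE')).
rewrite YE -/t1 -/t2 in UDperm.
(* The lower trapezoid starts at [l]; the translated list, starting at 0, is the one in
   [semihex_vandermonde]. *)
rewrite -(vandermonde_shift l (fern_ups true 0 t2)) -fern_ups_shift addn0.
rewrite -(eq_gap_sum _ _ _ UDperm).
pose se := z + osum a + esum b + esum c.
pose q := se + r.
have st1 : sumn t1 = Y + x + z + sumn c + sumn b by rewrite sumn_upper_dents // YE; lia.
have st2 : sumn t2 = sumn a + x + z + sumn c + sumn b + r.
  by rewrite sumn_lower_dents //; lia.
have ot1 : osum t1 = l + esum a + osum c + osum b by apply: osum_upper_dents.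
have ot2 : osum t2 = osum a + esum c + esum b + r by apply: osum_lower_dents.
have sb : sumn b <= l + sumn a + (x + z) + sumn c + sumn b by lia.
(* The line, at level [q], is [r] rows above the east vertex and [l] rows below the west vertex, so
   the southwest side is [q + l]. *)
have RE u : (u \in Rleft x y z a c b) =
    (u \in hexagon 0 0 se (x + esum a + osum b + osum c) (q + l)
              (z + esum a + osum b + osum c))
    && ~~ [|| in_fern false (l, q) a u, in_fern true (Y + g, q) c u
         | in_fern false (Y + g + sumn c + g', q) (rev b) u].
  have -> : Y + g + sumn c + g' = l + sumn a + (x + z) + sumn c + sumn b - sumn b by lia.
  have <- : in_rfern true (l + sumn a + (x + z) + sumn c + sumn b, q) b u =
      in_fern false (l + sumn a + (x + z) + sumn c + sumn b - sumn b, q) (rev b) u.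
    by rewrite in_rfernE // eb.
  rewrite /Rleft in_filter_fset -YE.
  have sw : 2 * y + z + osum a + esum b + esum c
    + (maxn (sumn a) (sumn b) - minn (sumn a) (sumn b)) = q + l.
    by rewrite /q /se /l /r /nu; lia.
  have qE : z + osum a + esum b + esum c
    + (if sumn a <= sumn b then y else y + sumn a - sumn b) = q.
    by rewrite /q /se /r /nu; case: leqP; lia.
  rewrite sw qE; case: u => b1 [i j]; rewrite !in_hexagon.
  have -> : q + l - q = l by lia.
  have -> : minn (q + l + (x + esum a + osum b + osum c))
     (q + l + (x + esum a + osum b + osum c) + (z + osum a + esum b + esum c) - q) =
     l + sumn a + (x + z) + sumn c + sumn b by rewrite /q /se; lia.
  by [].
apply: (@M_fern_line _ q l (sumn t1) (osum t1 + z) (sumn t2) (osum t2 + z)) => //.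
- move=> b1 i j qj; rewrite RE in_fern_upper_dents // YE [in RHS]negb_or [RHS]andbA.
  congr (_ && _); rewrite in_hexagon in_trapezoid in_triangle_up st1 ot1.
  by case: b1; rewrite /q /se; lia.
- move=> b1 i k kq; rewrite RE !in_fern_reflect // in_fern_lower_dents // YE.
  rewrite !orbA [_ || in_triangle _ _ _ _]orbC [in RHS]negb_or [RHS]andbA.
  congr (_ && _).
  rewrite in_hexagon in_trapezoid in_triangle_up st2 ot2.
  by rewrite /q /se in kq *; case: b1 => /=; lia.
- by move=> b1 i j jq; rewrite RE in_hexagon => /andP[/and4P[]]; lia.
- by rewrite st1 ot1; lia.
- by rewrite st2 ot2; lia.
- by rewrite /q /se; lia.
- by rewrite ot2 /q /se; lia.
- move=> i lin; rewrite -negb_or -mem_cat (perm_mem UDperm).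
  by rewrite !mem_cat !mem_iota; lia.
- move=> i; rewrite mem_cat !mem_iota st1 st2; lia.
Qed.

(** * Vandermonde products of intervals and the count for the cored hexagon *)

Lemma prod_dist_iota p m k :
  (\prod_(s <- iota p m) `|s - (p + m + k)|) * k`! = (m + k)`!.
Proof.
elim: m p => [|m IHm] p; first by rewrite big_nil mul1n.
rewrite big_cons -mulnA [p + m.+1]addnS -addSn IHm.
have -> : `|p - (p.+1 + m + k)| = (m + k).+1 by lia.
by rewrite -factS.
Qed.

Lemma vandermonde_iota p n : vandermonde (iota p n) = hyperfact n.
Proof.
elim: n p => [|n IHn] p /=; first by rewrite /hyperfact big_ord0.
rewrite IHn hyperfactS mulnC; congr (_ * _); rewrite fact_prod big_add1 /=.
rewrite -[in LHS](addn0 p.+1) iotaDl big_map /index_iota subn0.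
by apply: eq_bigr => i _; lia.
Qed.

(** Each new right end contributes a quotient of factorials by [prod_dist_iota]. With [m = mu + y]
    and [n = c] this is the origin of the factors of the theorem in [g], and of one of the two
    [H (mu + y)] in the denominator. *)
Lemma vandermonde_two_intervals p m g n :
  vandermonde (iota p m ++ iota (p + m + g) n) * (hyperfact (m + g) * hyperfact (g + n)) =
  hyperfact m * hyperfact n * (hyperfact (m + g + n) * hyperfact g).
Proof.
rewrite vandermonde_cat !vandermonde_iota -!mulnA; congr (_ * (_ * _)).
elim: n => [|n IHn].
  by rewrite big1_seq => [|s _]; rewrite ?big_nil // mul1n !addn0.
have -> : iota (p + m + g) n.+1 = iota (p + m + g) n ++ [:: p + m + g + n].
  by rewrite -[n.+1]addn1 iotaD.
under eq_bigr do rewrite big_cat big_seq1 /=.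
rewrite big_split /= !addnS !hyperfactS.
have -> : p + m + g + n = p + m + (g + n) by lia.
have := prod_dist_iota p m (g + n).
set P1 := (X in X * _ = _); set P2 := (X in X * P1 * _) => e.
rewrite -[m + g + n]addnA -e mulnA [hyperfact _ * (P1 * _)]mulnC.
rewrite addnA -[RHS]mulnA -IHn -/P2; ring.
Qed.

Lemma in_triangle0 up P u : in_triangle up P 0 u = false.
Proof.
case: P u => [p q] [b [i j]]; case: up.
  by rewrite in_triangle_up; case: b; lia.
by rewrite in_triangle_down; case: b; lia.
Qed.

(** [2 * y + z] has the parity of [z] but not of [x], so the core is half a unit west of the center,
    in accordance with the rounding of the gaps to [g] and [g']. Zero sides give the ferns a
    positive even length. *)
Lemma cored_hexagon_Rleft x y z n : odd x != odd z ->
  cored_hexagon x (2 * y + z) z n = Rleft x y z [:: 0; 0] [:: n; 0] [:: 0; 0].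
Proof.
move=> hxz; apply/fsetP=> -[b [i j]].
rewrite [LHS]in_filter_fset [RHS]in_filter_fset.
rewrite !(osum_cons, esum_cons, osum_nil, esum_nil) !in_hexagon /=.
rewrite !in_triangle0 ?orbF /= maxnn subnn !addn0 ?add0n.
have odd_x : odd x = ~~ odd z by case: (odd x) (odd z) hxz => [] [].
have -> : core_vertex x (2 * y + z) z = (y + (x + z)./2, z + y).
  rewrite /core_vertex oddD oddM /= odd_x eqxx andbT.
  case: (boolP (~~ odd z == odd z)); first by case: (odd z).
  move=> _; rewrite (_ : x + (2 * y + z) - 1 = (y + (x + z)./2).*2).
    by rewrite (_ : 2 * y + z + z = (z + y).*2) ?doubleK //; lia.
  by have := odd_double_half (x + z); rewrite oddD odd_x; case: (odd z) => /=; lia.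
by congr (_ && _); congr (~~ in_triangle _ _ _ _); congr (_, _); lia.
Qed.

Lemma M_cored_hexagon x Y z n : odd x != odd z ->
  let g := (x + z)./2 in let g' := uphalf (x + z) in
  M (cored_hexagon x (2 * Y + z) z n)
    * (hyperfact (Y + n + z) * hyperfact (Y + z))
    * (hyperfact (Y + g) * hyperfact (g + n)) =
  hyperfact Y * hyperfact n * (hyperfact (Y + g + n) * hyperfact g) * hyperfact Y
  * gap_sum (Y + g + n + g') z (core_gaps Y g g' n) (core_intervals Y g g' n).
Proof.
move=> hxz g g'; rewrite cored_hexagon_Rleft //.
have := @M_Rleft x Y z [:: 0; 0] [:: 0; 0] [:: n; 0] isT isT isT isT isT isT; cbv zeta.
rewrite [sumn [:: 0; 0]]/= [sumn [:: n; 0]]/= maxnn minnn !addn0 subn0 add0n -/g -/g'.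
set t1 := upper_dents _ _ _ _ _ _; set t2 := lower_dents _ _ _ _ _ _.
rewrite (_ : osum t1 = Y + n); last first.
  by rewrite [LHS]osum_upper_dents // !(osum_cons, esum_cons, osum_nil, esum_nil) !addn0.
rewrite (_ : osum t2 = Y); last first.
  by rewrite [LHS]osum_lower_dents // !(osum_cons, esum_cons, osum_nil, esum_nil) !addn0.
have -> : fern_ups true 0 t1 = iota 0 Y ++ iota (0 + Y + g) n.
  by rewrite /= !addn0 cats0.
have -> : fern_ups true 0 t2 = iota (g + n + g') Y.
  by rewrite /= !addn0 !cats0 !add0n.
rewrite vandermonde_iota => ->.
by rewrite -(vandermonde_two_intervals 0); ring.
Qed.

Local Open Scope ring_scope.

Theorem theorem2p3 (x y z : nat) (a b c : seq nat)
  (hxz : odd x != odd z)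
  (ha : (0 < size a)%N /\ ~~ odd (size a))
  (hb : (0 < size b)%N /\ ~~ odd (size b))
  (hc : (0 < size c)%N /\ ~~ odd (size c)) :
  let sa := sumn a in
  let sb := sumn b in
  let sc := sumn c in
  let g := ((x + z)./2)%N in
  let g' := uphalf (x + z)%N in
  let mu := maxn sa sb in
  let nu := minn sa sb in
  let H := fun n : nat => (hyperfact n)%:R : rat in
  (M (Rleft x y z a c b))%:R =
    (M (cored_hexagon x (2 * y + z + 2 * mu)%N z sc))%:R
    * (semihex ((y + sb - nu)%N :: a ++ g :: take (size c).-1 c
                ++ (last 0%N c + g' + last 0%N b)%N :: rev (take (size b).-1 b)))%:R
    * (semihex (take (size a).-1 a ++ (last 0%N a + g + head 0%N c)%N :: behead c
                ++ g' :: rev b ++ [:: (y + sa - nu)%N]))%:R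
    * (H (sc + g)%N / (H sc * H g))
    * (H (mu + y + g)%N / H (mu + sc + y + g)%N)
    * (H (mu + y + z)%N * H (mu + sc + y + z)%N
       / (H (mu - osum a + osum b + osum c + y + z)%N
          * H (mu + osum a - osum b + esum c + y + z)%N))
    * (H (mu - osum a + osum b + osum c + y)%N
       * H (mu + osum a - osum b + esum c + y)%N
       / H (mu + y)%N ^+ 2).
Proof.
move=> sa sb sc g g' mu nu H.
have [[a0 ea] [b0 eb] [c0 ec]] := And3 ha hb hc.
have [oea oeb] := conj (osumDesum a) (osumDesum b).
set t1 := _ :: _; set t2 := _ ++ _.
(* The truncated subtractions are exact: [osum a] is at most [sa], [osum b] at most [sb], and both
   sums are at most [mu]. *)
have ot1 : osum t1 = (mu - osum a + osum b + osum c + y)%N.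
  rewrite [LHS]osum_upper_dents // /mu /nu /sa /sb; lia.
have ot2 : osum t2 = (mu + osum a - osum b + esum c + y)%N.
  rewrite [LHS]osum_lower_dents // /mu /nu /sa /sb; lia.
have YE : (mu + y)%N = (maxn (sumn a) (sumn b) + y)%N by [].
have := M_Rleft x y z a0 ea b0 eb c0 ec; cbv zeta.
rewrite -[upper_dents _ _ _ _ _ _]/t1 -[lower_dents _ _ _ _ _ _]/t2.
rewrite -!semihex_vandermonde ot1 ot2 -YE -/g -/g' -/sc => eR.
(* In this form the outer intervals of the cored hexagon have the length [mu + y] found for
   [Rleft]. *)
have -> : (2 * y + z + 2 * mu)%N = (2 * (mu + y) + z)%N by lia.
have := M_cored_hexagon (mu + y) sc hxz; cbv zeta; rewrite -/g -/g' => eC.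
have H_neq0 n : H n != 0.
  by rewrite /H pnatr_eq0 -lt0n prodn_gt0 // => i; apply: fact_gt0.
(* Both counts contain the same [F]. The hyperfactorials involving [z] come from the heights of the
   four halves, those of [osum t1] and [osum t2] from the semihexagons. *)
set F := gap_sum _ _ _ _ in eR eC.
have := congr1 (fun n => n%:R : rat) eR; have := congr1 (fun n => n%:R : rat) eC.
have -> : (mu + sc + y + z = mu + y + sc + z)%N by lia.
have -> : (mu + sc + y + g = mu + y + g + sc)%N by lia.
rewrite [(sc + g)%N]addnC !natrM -!/(H _) => {}eC {}eR.
(* Solving for the two counts leaves [F] in numerators only, so no division by [F] occurs. *)
rewrite (canRL (mulfK _) eR) ?mulf_neq0 ?H_neq0 //.
rewrite -mulrA in eC; rewrite (canRL (mulfK _) eC) ?mulf_neq0 ?H_neq0 //.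
by field; rewrite !H_neq0.
Qed.
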